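(* Let $V_1,\dots,V_4$ be finite-dimensional $Q$-modules with actions $\pi_1,\dots,\pi_4$, and let $f:U\to V_1\otimes\cdots\otimes V_4$ be a smooth function satisfying the Ward identities. Write $W=V_1\otimes\cdots\otimes V_4$ and define $F:\tilde G\to W$ by $g\mapsto f(1,w,g,gw)$. Then $F$ is a matrix-spherical function for the symmetric subgroup $MA$ of $G$ (i.e. $(G^\sigma)_0\le MA\le G^\sigma$ for an involution $\sigma$ of $G$, and $F(hgh')=h\cdot F(g)\cdot h'$ for all $g\in\tilde G$, $h,h'\in MA$) with respect to the following left and right actions of $MA$ on $W$ ($m\in M,a\in A$): $$(ma)\cdot(v_1\otimes v_2\otimes v_3\otimes v_4)=(ma\cdot v_1)\otimes(wmaw\cdot v_2)\otimes v_3\otimes v_4,$$ $$(v_1\otimes v_2\otimes v_3\otimes v_4)\cdot(ma)=v_1\otimes v_2\otimes(m^{-1}a^{-1}\cdot v_3)\otimes(wm^{-1}a^{-1}w\cdot v_4).$$ The map $f\mapsto F$ is injective.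
   Context: Let $p\ge q\ge0$ be integers, $d=p+q>2$, and let $\eta$ be the bilinear form $\operatorname{diag}(1^{p+1},(-1)^{q+1})$ on $\mathbb R^{p+1,q+1}=\mathbb R^{d+2}$ with standard basis $e_0,\dots,e_{d+1}$. $G=SO(p+1,q+1)_0$ (identity component). $\widehat{\mathbb R^{p,q}}=\{[v]\in\mathbb{RP}^{d+1}:v\ne0,\ \eta(v,v)=0\}$, on which $G$ acts transitively. Put $\iota(0)=[e_0+e_{d+1}]$ and $\infty=[e_0-e_{d+1}]$; $Q\le G$ is the stabiliser of $\iota(0)$, so $G/Q\cong\widehat{\mathbb R^{p,q}}$ via $gQ\mapsto g\cdot\iota(0)$. A tuple $([v_1],\dots,[v_m])$ of points of $\widehat{\mathbb R^{p,q}}$ is in general position if $v_1,\dots,v_m$ are linearly independent and $\eta(v_i,v_j)\ne0$ for all $i\neq j$; the set of such tuples is $\operatorname{GP}(G/Q,m)$. $U\subseteq G^{\times4}$ is the preimage of $\operatorname{GP}(G/Q,4)$ under $G^{\times4}\to(G/Q)^{\times4}$. A smooth $f:U\to V_1\otimes\cdots\otimes V_4$ satisfies the Ward identities if $f(gg_1q_1,\dots,gg_4q_4)=\big(\pi_1(q_1)^{-1}\otimes\cdots\otimes\pi_4(q_4)^{-1}\big)f(g_1,\dots,g_4)$ for all $g\in G$, $(g_1,\dots,g_4)\in U$, $q_1,\dots,q_4\in Q$. Let $D_0\in\mathfrak g=\mathfrak{so}(p+1,q+1)$ be the element with $D_0e_0=e_{d+1}$, $D_0e_{d+1}=e_0$,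 $D_0e_i=0$ for $1\le i\le d$; $\mathfrak a=\mathbb RD_0$, $A=\exp(\mathfrak a)$, and $M={}^0Z_G(\mathfrak a)$ is the intersection of the kernels of all continuous homomorphisms $Z_G(\mathfrak a)\to\mathbb R_{>0}$, so that $MA=Z_G(\mathfrak a)$ (which is also the stabiliser in $G$ of the pair $(\iota(0),\infty)$). $w\in G$ is a fixed diagonal matrix with $w^2=1$ that exchanges $\iota(0)$ and $\infty$; conjugation by $w$ is an automorphism of $MA$. $\tilde G\subseteq G$ is the open dense $MA$-biinvariant set of $g\in G$ such that $(\iota(0),\infty,g\cdot\iota(0),g\cdot\infty)\in\operatorname{GP}(G/Q,4)$. *)

(* Defs.v *)
From HB Require Import structures.
From mathcomp Require Import all_boot all_order all_algebra all_field.
From mathcomp Require Import all_classical all_reals all_analysis.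
Set Implicit Arguments.
Unset Strict Implicit.
Unset Printing Implicit Defensive.
Import Order.TTheory GRing.Theory Num.Theory.
Import numFieldNormedType.Exports.
Local Open Scope classical_set_scope.
Local Open Scope ring_scope.

Section Tensor.
Variable K : fieldType.

(* V (x) W is realised as Hom(V^*, W), the pure tensor v (x) w being
   phi |-> phi(v) w; for finite-dimensional V, W this is the tensor product. *)
Definition tensor (V W : vectType K) : vectType K := 'Hom('Hom(V, K^o), W).

Definition pure_fun (V W : vectType K) (v : V) (w : W)
    (phi : 'Hom(V, K^o)) : W := (phi v : K) *: w.

Lemma pure_fun_linear (V W : vectType K) (v : V) (w : W) :
  linear (pure_fun v w).
Proof.
by move=> a x y; rewrite /pure_fun add_lfunE scale_lfunE scalerDl -scalerA.
Qed.
HB.instance Definition _ (V W : vectType K) (v : V) (w : W) :=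
  GRing.isLinear.Build K _ _ _ (pure_fun v w) (pure_fun_linear v w).

Definition pure (V W : vectType K) (v : V) (w : W) : tensor V W :=
  linfun (pure_fun v w).

Definition precomp_fun (V V' : vectType K) (f : 'Hom(V, V'))
    (phi : 'Hom(V', K^o)) : 'Hom(V, K^o) := (phi \o f)%VF.

Lemma precomp_fun_linear (V V' : vectType K) (f : 'Hom(V, V')) :
  linear (precomp_fun f).
Proof. by move=> a x y; rewrite /precomp_fun comp_lfunDl comp_lfunZl. Qed.
HB.instance Definition _ (V V' : vectType K) (f : 'Hom(V, V')) :=
  GRing.isLinear.Build K _ _ _ (precomp_fun f) (precomp_fun_linear f).

Definition tmap_fun (V V' W W' : vectType K) (f : 'Hom(V, V'))
    (g : 'Hom(W, W')) (T : tensor V W) : tensor V' W' :=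
  (g \o (T \o linfun (precomp_fun f)))%VF.

Lemma tmap_fun_linear (V V' W W' : vectType K)
    (f : 'Hom(V, V')) (g : 'Hom(W, W')) : linear (tmap_fun f g).
Proof.
move=> a x y.
by rewrite /tmap_fun comp_lfunDl comp_lfunDr -comp_lfunZl -comp_lfunZr.
Qed.
HB.instance Definition _ (V V' W W' : vectType K)
    (f : 'Hom(V, V')) (g : 'Hom(W, W')) :=
  GRing.isLinear.Build K _ _ _ (tmap_fun f g) (tmap_fun_linear f g).

Definition tmap (V V' W W' : vectType K) (f : 'Hom(V, V')) (g : 'Hom(W, W'))
    : 'Hom(tensor V W, tensor V' W') := linfun (tmap_fun f g).

Lemma tmapE (V V' W W' : vectType K)
    (f : 'Hom(V, V')) (g : 'Hom(W, W')) (v : V) (w : W) :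
  tmap f g (pure v w) = pure (f v) (g w).
Proof.
apply/lfunP => phi.
rewrite /tmap lfunE /= /tmap_fun !comp_lfunE /pure !lfunE /= /pure_fun.
by rewrite linearZ /precomp_fun comp_lfunE.
Qed.

Definition tensor4 (V1 V2 V3 V4 : vectType K) : vectType K :=
  tensor V1 (tensor V2 (tensor V3 V4)).

Definition pure4 (V1 V2 V3 V4 : vectType K) (v1 : V1) (v2 : V2) (v3 : V3)
    (v4 : V4) : tensor4 V1 V2 V3 V4 :=
  pure v1 (pure v2 (pure v3 v4)).

Definition tmap4 (V1 V2 V3 V4 : vectType K) (f1 : 'End(V1)) (f2 : 'End(V2))
    (f3 : 'End(V3)) (f4 : 'End(V4)) : 'End(tensor4 V1 V2 V3 V4) :=
  tmap f1 (tmap f2 (tmap f3 f4)).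

Lemma tmap4E (V1 V2 V3 V4 : vectType K) (f1 : 'End(V1)) (f2 : 'End(V2))
    (f3 : 'End(V3)) (f4 : 'End(V4)) v1 v2 v3 v4 :
  tmap4 f1 f2 f3 f4 (pure4 v1 v2 v3 v4) = pure4 (f1 v1) (f2 v2) (f3 v3) (f4 v4).
Proof. by rewrite /tmap4 /pure4 !tmapE. Qed.

End Tensor.

Section Smooth.
Variables (R : realType) (E : normedModType R).

(* class C^k on O (meant for O open) *)
Fixpoint Ck (k : nat) (O : set E) (h : E -> R) : Prop :=
  match k with
  | 0 => forall x, O x -> {for x, continuous h}
  | k'.+1 => (forall x, O x -> differentiable h x) /\
             (forall v, Ck k' O (fun x => 'D_v h x))
  end.

(* Smoothness on a subset U of E: near each point of U, h extends to a smooth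
   function on an open subset of E.  If U is an embedded submanifold, these are
   the smooth functions on the manifold U. *)
Definition smooth_on (U : set E) (h : E -> R) : Prop :=
  forall x, U x -> exists (O : set E) (h' : E -> R),
    [/\ open O, O x, (forall k, Ck k O h') &
        forall y, U y -> O y -> h y = h' y].

(* Coordinates of a map to a K-space W, K a finite extension of R, are the
   R-linear functionals of its K-linear functionals. *)
Definition vsmooth_on (K : fieldExtType R) (W : vectType K) (U : set E)
    (f : E -> W) : Prop :=
  forall (phi : 'Hom(W, K^o)) (lam : 'Hom(K, R^o)),
    smooth_on U (fun x => lam (phi (f x))).

End Smooth.

Section MatrixGroups.
Variables (R : realType) (n : nat).
Local Notation mx := 'M[R]_n.+1.

Definition mexp (X : mx) : mx :=
  lim (series (fun k => (k`!%:R)^-1 *: X ^+ k) @ \oo).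

Definition is_subgroup (G H : set mx) : Prop :=
  [/\ H `<=` G, H 1, forall g h, H g -> H h -> H (g * h) &
      forall g, H g -> H g^-1].

Definition identity_component (H : set mx) : set mx := connected_component H 1.

Definition is_involution (G : set mx) (sigma : mx -> mx) : Prop :=
  [/\ {within G, continuous sigma}, forall g, G g -> G (sigma g),
      forall g h, G g -> G h -> sigma (g * h) = sigma g * sigma h &
      forall g, G g -> sigma (sigma g) = g].

Definition fixed_subgroup (G : set mx) (sigma : mx -> mx) : set mx :=
  [set g | G g /\ sigma g = g].

Definition symmetric_subgroup (G H : set mx) : Prop :=
  is_subgroup G H /\
  exists2 sigma, is_involution G sigma &
    identity_component (fixed_subgroup G sigma) `<=` H /\
    H `<=` fixed_subgroup G sigma.

Variable K : fieldType.

Definition is_module (H : set mx) (V : vectType K) (rho : mx -> 'End(V)) : Prop :=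
  rho 1 = \1%VF /\
  forall g h, H g -> H h -> rho (g * h) = (rho g \o rho h)%VF.

Definition is_right_module (H : set mx) (V : vectType K) (rho : mx -> 'End(V))
    : Prop :=
  rho 1 = \1%VF /\
  forall g h, H g -> H h -> rho (g * h) = (rho h \o rho g)%VF.

(* D is the part of G on which F is defined; h . x = lact h x and
   x . h = ract h x. *)
Definition matrix_spherical (G H D : set mx) (W : vectType K)
    (lact ract : mx -> 'End(W)) (F : mx -> W) : Prop :=
  [/\ symmetric_subgroup G H, is_module H lact, is_right_module H ract &
      forall g h h', D g -> H h -> H h' ->
        F (h * g * h') = ract h' (lact h (F g))].

End MatrixGroups.

Section Conformal.
Variables (R : realType) (p q : nat).
Local Notation mx := 'M[R]_((p + q).+2).
Local Notation vec := 'cV[R]_((p + q).+2).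

Definition eta_mx : mx :=
  diag_mx (\row_(i < (p + q).+2) (if (i < p.+1)%N then 1 else -1)).

Definition eta (u v : vec) : R := (u^T *m eta_mx *m v) ord0 ord0.

Definition SO : set mx := [set g | g^T *m eta_mx *m g = eta_mx /\ \det g = 1].

Definition Gpq : set mx := identity_component SO.

Definition std (i : 'I_((p + q).+2)) : vec := delta_mx i ord0.

(* The point [v] of projective space, as the line through v without 0 *)
Definition pt (v : vec) : set vec := [set c *: v | c in [set c : R | c != 0]].

Definition quadric : set (set vec) :=
  [set pt v | v in [set v | v != 0 /\ eta v v = 0]].

Definition gact (g : mx) (x : set vec) : set vec := (mulmx g) @` x.

Definition iota0 : set vec := pt (std ord0 + std ord_max).
Definition infty : set vec := pt (std ord0 - std ord_max).

Definition Qpq : set mx := [set g | Gpq g /\ gact g iota0 = iota0].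

Definition GP (m : nat) : set (m.-tuple (set vec)) :=
  [set x | (forall i, quadric (tnth x i)) /\
    exists v : m.-tuple vec,
      [/\ forall i, tnth x i = pt (tnth v i), free v &
          forall i j, i != j -> eta (tnth v i) (tnth v j) != 0]].

Definition Upq : set (mx * mx * mx * mx) :=
  [set g | let: (g1, g2, g3, g4) := g in
    [/\ Gpq g1, Gpq g2, Gpq g3 & Gpq g4] /\
    GP [tuple gact g1 iota0; gact g2 iota0; gact g3 iota0; gact g4 iota0]].

Definition D0 : mx := delta_mx ord_max ord0 + delta_mx ord0 ord_max.

Definition a_alg : set mx := [set t *: D0 | t in [set: R]].

Definition Apq : set mx := (@mexp R _) @` a_alg.

Definition ZGa : set mx :=
  [set g | Gpq g /\ forall X, a_alg X -> g * X * g^-1 = X].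

Definition is_pos_character (H : set mx) (chi : mx -> R) : Prop :=
  [/\ {within H, continuous chi}, forall g, H g -> 0 < chi g &
      forall g h, H g -> H h -> chi (g * h) = chi g * chi h].

Definition Mpq : set mx :=
  [set m | ZGa m /\ forall chi, is_pos_character ZGa chi -> chi m = 1].

Definition MApq : set mx := [set m * a | m in Mpq & a in Apq].

Definition Gtilde : set mx :=
  [set g | Gpq g /\ GP [tuple iota0; infty; gact g iota0; gact g infty]].

Definition is_w (w : mx) : Prop :=
  [/\ Gpq w, is_diag_mx w, w * w = 1, gact w iota0 = infty &
      gact w infty = iota0].

Section Ward.
Variables (K : fieldExtType R) (V1 V2 V3 V4 : vectType K).
Local Notation W := (tensor4 V1 V2 V3 V4).
Variables (pi1 : mx -> 'End(V1)) (pi2 : mx -> 'End(V2)).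
Variables (pi3 : mx -> 'End(V3)) (pi4 : mx -> 'End(V4)).

Definition ward (f : mx * mx * mx * mx -> W) : Prop :=
  forall g g1 g2 g3 g4 q1 q2 q3 q4,
    Gpq g -> Upq (g1, g2, g3, g4) -> Qpq q1 -> Qpq q2 -> Qpq q3 -> Qpq q4 ->
    f (g * g1 * q1, g * g2 * q2, g * g3 * q3, g * g4 * q4) =
    tmap4 (pi1 q1)^-1%VF (pi2 q2)^-1%VF (pi3 q3)^-1%VF (pi4 q4)^-1%VF
      (f (g1, g2, g3, g4)).

Definition smooth_ward (f : mx * mx * mx * mx -> W) : Prop :=
  vsmooth_on Upq f /\ ward f.

End Ward.

Definition restrictF (T : Type) (w : mx) (f : mx * mx * mx * mx -> T) : mx -> T :=
  fun g => f (1, w, g, g * w).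

End Conformal.

Arguments SO R p q : clear implicits.
Arguments Gpq R p q : clear implicits.
Arguments Qpq R p q : clear implicits.
Arguments Upq R p q : clear implicits.
Arguments Apq R p q : clear implicits.
Arguments ZGa R p q : clear implicits.
Arguments Mpq R p q : clear implicits.
Arguments MApq R p q : clear implicits.
Arguments Gtilde R p q : clear implicits.

(* Main.v *)
Require Import Defs.
From HB Require Import structures.
From mathcomp Require Import all_boot all_order all_algebra all_field.
From mathcomp Require Import all_classical all_reals all_analysis.
From mathcomp Require Import ring lra.
Set Implicit Arguments.
Unset Strict Implicit.
Unset Printing Implicit Defensive.
Import Order.TTheory GRing.Theory Num.Theory.
Import numFieldNormedType.Exports.
Local Open Scope classical_set_scope.
Local Open Scope ring_scope.

(* For sigma the conjugation by 1 - 2 D0^2, G^sigma consists of the elements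
   commuting with D0^2; by connectedness the identity component of this group
   preserves both null lines of the plane of D0, hence lies in Z_G(a).  The substance of MA = Z_G(a) is
   that every positive character of Z_G(a) kills the elements acting by a sign on
   that plane.  Characters kill involutions, and every rotation or boost in a
   coordinate plane orthogonal to that of D0 is a product of two involutions of
   Z_G(a) (this uses d > 2); Gaussian elimination by such plane rotations reduces
   an element to a diagonal sign matrix.
   For injectivity, G acts transitively on the pairs of non-orthogonal points of
   the quadric (Siegel transformations), so that every point of U can be written
   (g q1, g w q2, g h q3, g h w q4); the Ward identities then give f there in
   terms of f(1, w, h, hw). *)

(** * Continuity of matrix-valued maps, and signs on connected sets *)

Section MatrixContinuity.
Variables (R : realType) (T : topologicalType).

Lemma continuous_matrix m n (f : T -> 'M[R]_(m, n)) :
  (forall i j, continuous (fun t => f t i j)) -> continuous f.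
Proof.
move=> fc t A [P Pn PA].
have : \forall s \near t, forall ij : 'I_m * 'I_n, P ij.1 ij.2 (f s ij.1 ij.2).
  by apply: filter_forall => -[i j] /=; exact: fc (Pn i j).
by apply: filterS => s Ps; apply: PA => i j; exact: (Ps (i, j)).
Qed.

Lemma continuous_entry m n (f : T -> 'M[R]_(m, n)) i j :
  continuous f -> continuous (fun t => f t i j).
Proof.
move=> fc t; apply: (@continuous_comp _ _ _ f (fun M : 'M[R]_(m, n) => M i j)).
  exact: fc.
exact: coord_continuous.
Qed.

Lemma continuous_mulmx m n k (f : T -> 'M[R]_(m, n)) (g : T -> 'M[R]_(n, k)) :
  continuous f -> continuous g -> continuous (fun t => f t *m g t).
Proof.
move=> fc gc; apply: continuous_matrix => i j.
under eq_fun do rewrite mxE.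
apply: continuous_big => [|l _]; first exact: add_continuous.
move=> t; apply: (@continuousM _ _ (fun s => f s i l) (fun s => g s l j));
  exact: continuous_entry.
Qed.

Lemma continuous_trmx m n (f : T -> 'M[R]_(m, n)) :
  continuous f -> continuous (fun t => (f t)^T).
Proof.
move=> fc; apply: continuous_matrix => i j.
under eq_fun do rewrite mxE.
exact: continuous_entry.
Qed.

Lemma continuous_det n (f : T -> 'M[R]_n) :
  continuous f -> continuous (fun t => \det (f t)).
Proof.
move=> fc; rewrite /determinant.
apply: continuous_big => [|s _]; first exact: add_continuous.
move=> t; apply: (@continuousM _ _ (cst _)); first exact: cst_continuous.
apply: continuous_big => [|i _].
  exact: mul_continuous.
exact: continuous_entry.
Qed.

End MatrixContinuity.

(** The image of a connected set in the reals is an interval, so values of both signs would force a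
    zero. *)
Lemma connected_sign (R : realType) (T : topologicalType) (C : set T)
    (h : T -> R) x y :
  connected C -> continuous h -> (forall z, C z -> h z != 0) ->
  C x -> C y -> 0 < h x -> 0 < h y.
Proof.
move=> Cc hc h0 Cx Cy hx; rewrite ltNge le_eqVlt (negbTE (h0 _ Cy)) /=.
apply/negP => hy.
have /connected_intervalP hC : connected (h @` C).
  by apply: connected_continuous_connected => //; exact: continuous_subspaceT.
have [z Cz hz] : (h @` C) 0.
  by apply: (hC (h y) (h x)); [exists y|exists x|rewrite !ltW].
by move: (h0 _ Cz); rewrite hz eqxx.
Qed.

(** * The orthogonal group of the form and its identity component *)

Section Conformal.
Variables (R : realType) (p q : nat).
Local Notation mx := 'M[R]_((p + q).+2).
Local Notation vec := 'cV[R]_((p + q).+2).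
Local Notation ix := 'I_((p + q).+2).
Local Notation G := (Gpq R p q).
Local Notation J := (eta_mx R p q).
Local Notation e := (std R).
Local Notation eta := Defs.eta.
Implicit Types (g h : mx) (u v x y : vec) (i j k : ix).

Definition sgn_eta i : R := if (i < p.+1)%N then 1 else -1.
Local Notation s := sgn_eta.

Lemma sgn_etaM i : s i * s i = 1.
Proof. by rewrite /sgn_eta; case: ifP => _; ring. Qed.

Lemma sgn_eta_cases i : s i = 1 \/ s i = -1.
Proof. by rewrite /sgn_eta; case: ifP => _; [left|right]. Qed.

Lemma sgn_eta_neq0 i : s i != 0.
Proof. by rewrite /sgn_eta; case: ifP => _; rewrite ?oppr_eq0 oner_eq0. Qed.

Lemma sgn_eta_eqM i j : s i = s j -> s i * s j = 1.
Proof. by move=> <-; exact: sgn_etaM. Qed.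

Lemma sgn_eta_neqM i j : s i != s j -> s i * s j = -1.
Proof.
by case: (sgn_eta_cases i) (sgn_eta_cases j) => -> [] ->; rewrite ?eqxx // => _; ring.
Qed.

Lemma sgn_eta0 : s ord0 = 1. Proof. by []. Qed.

Lemma sgn_eta_max : s ord_max = -1.
Proof. by rewrite /sgn_eta /= ltnS ltnNge leq_addr. Qed.

Lemma etaE u v : eta u v = \sum_i s i * u i ord0 * v i ord0.
Proof.
rewrite /eta mxE; apply: eq_bigr => i _; congr (_ * _).
rewrite mxE (bigD1 i) //= big1 => [|j jNi].
  by rewrite !mxE eqxx mulr1n addr0 mulrC.
by rewrite !mxE (negbTE jNi) mulr0n mulr0.
Qed.

Lemma etaC u v : eta u v = eta v u.
Proof. by rewrite !etaE; apply: eq_bigr => i _; rewrite mulrAC. Qed.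

Lemma etaDl u v x : eta (u + v) x = eta u x + eta v x.
Proof. by rewrite /eta linearD /= !mulmxDl mxE. Qed.

Lemma etaZl (c : R) u v : eta (c *: u) v = c * eta u v.
Proof. by rewrite /eta linearZ /= -!scalemxAl mxE. Qed.

Lemma etaDr x u v : eta x (u + v) = eta x u + eta x v.
Proof. by rewrite /eta mulmxDr mxE. Qed.

Lemma etaZr (c : R) u v : eta u (c *: v) = c * eta u v.
Proof. by rewrite /eta -scalemxAr mxE. Qed.

Lemma etaNl u v : eta (- u) v = - eta u v.
Proof. by rewrite -scaleN1r etaZl mulN1r. Qed.

Lemma etaNr u v : eta u (- v) = - eta u v.
Proof. by rewrite -scaleN1r etaZr mulN1r. Qed.

Lemma stdE i j : e i j ord0 = (j == i)%:R.
Proof. by rewrite mxE eqxx andbT. Qed.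

Lemma eta_std i v : eta (e i) v = s i * v i ord0.
Proof.
rewrite etaE (bigD1 i) //= big1 => [|j jNi]; last first.
  by rewrite stdE (negbTE jNi) mulr0 mul0r.
by rewrite stdE eqxx mulr1 addr0.
Qed.

Lemma mulmx_std g i : g *m e i = col i g.
Proof. by rewrite colE. Qed.

Lemma mulmx_stdE g i j : (g *m e i) j ord0 = g j i.
Proof. by rewrite mulmx_std mxE. Qed.

Lemma mx_std_inj g h : (forall i, g *m e i = h *m e i) -> g = h.
Proof.
move=> gh; apply/matrixP => i j.
by rewrite -!mulmx_stdE gh.
Qed.

Lemma mulr_act g h v : (g * h) *m v = g *m (h *m v).
Proof. exact/esym/mulmxA. Qed.

Definition isometry g := g^T *m J *m g = J.

Lemma isometryP g : isometry g <-> forall u v, eta (g *m u) (g *m v) = eta u v.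
Proof.
split => [gO u v|gO].
  by rewrite /eta trmx_mul -!mulmxA (mulmxA J) (mulmxA g^T) (mulmxA g^T) gO.
apply/matrixP => i j.
have etaM (A : mx) : ((e i)^T *m A *m e j) ord0 ord0 = A i j.
  by rewrite -mulmxA mulmx_std mxE (bigD1 i) //= big1 => [|k kNi];
    rewrite !mxE ?eqxx /= ?mul1r ?addr0 // (negbTE kNi) mul0r.
rewrite -[LHS]etaM -[RHS]etaM -/(eta (e i) (e j)) -gO.
by rewrite /eta trmx_mul !mulmxA.
Qed.

Lemma eta_mx2 : J * J = 1.
Proof.
rewrite /eta_mx -mulmxE mulmx_diag; apply/matrixP => i j; rewrite !mxE.
by case: (i == j); rewrite ?mulr0n // mulr1n; case: ifP => _; rewrite ?mulrNN mulr1.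
Qed.

(** Since [J * J = 1], the isometry equation says that [J * g^T * J] is a left inverse, and for
    square matrices a left inverse is two-sided. The formula also makes inversion visibly
    continuous. *)
Lemma isometryV g : isometry g -> g^-1 = J * g^T * J /\ g \is a GRing.unit.
Proof.
move=> gO; have gl : (J * g^T * J) * g = 1.
  have -> : J * g^T * J * g = J * (g^T *m J *m g) by rewrite -!mulmxE !mulmxA.
  by rewrite gO eta_mx2.
have gr : g * (J * g^T * J) = 1 by apply: (@mulmx1C _ _ (J * g^T * J) g); exact: gl.
have gu : g \is a GRing.unit by apply/unitrP; exists (J * g^T * J).
by split=> //; apply: (mulrI gu); rewrite gr mulrV.
Qed.

Lemma isometry_det g : isometry g -> \det g ^+ 2 = 1.
Proof.
move=> gO; have J0 : \det J != 0.
  have : \det (J * J) = 1 by rewrite eta_mx2 det1.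
  rewrite -mulmxE det_mulmx; case: eqP => // ->; rewrite mul0r.
  by move/esym/eqP; rewrite oner_eq0.
apply: (mulfI J0); rewrite mulr1 -[RHS](congr1 determinant gO).
by rewrite !det_mulmx det_tr; ring.
Qed.

Lemma isometryM g h : isometry g -> isometry h -> isometry (g * h).
Proof.
move=> /isometryP gO /isometryP hO; apply/isometryP => u v.
by rewrite !mulr_act gO hO.
Qed.

Lemma SO1 : SO R p q 1.
Proof. by split; [rewrite trmx1 mul1mx mulmx1|exact: det1]. Qed.

Lemma Gpq_SO g : G g -> SO R p q g.
Proof. exact: connected_component_sub. Qed.

Lemma Gpq_isometry g : G g -> isometry g.
Proof. by move/Gpq_SO => []. Qed.

Lemma Gpq_unit g : G g -> g \is a GRing.unit.
Proof. by move/Gpq_isometry/isometryV => []. Qed.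

Lemma Gpq_eta g u v : G g -> eta (g *m u) (g *m v) = eta u v.
Proof. by move/Gpq_isometry/isometryP. Qed.

Lemma Gpq1 : G 1.
Proof. exact/connected_component_refl/SO1. Qed.

(* The determinant is continuous with values in {1, -1} on O(eta). *)
Lemma connected_isometry_Gpq (C : set mx) g :
  connected C -> C 1 -> (forall h, C h -> isometry h) -> C g -> G g.
Proof.
move=> Cc C1 CO Cg; exists C => //; split => // h Ch; split; first exact: CO.
have : 0 < \det h.
  apply: (@connected_sign _ _ C (fun h : mx => \det h) 1) => //.
  - by apply: continuous_det; move=> x; exact: cvg_id.
  - move=> x /CO/isometry_det; case: eqP => // ->; rewrite expr0n.
    by move/esym/eqP; rewrite oner_eq0.
  - by rewrite det1.
move: (isometry_det (CO _ Ch)) => /eqP; rewrite sqrf_eq1 => /orP[/eqP //|/eqP ->].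
by rewrite oppr_gt0 ltr10.
Qed.

(** The standard way below to place an isometry in the identity component: a path of isometries from
    1 suffices, the determinant being constant along it. *)
Lemma path_Gpq (f : R -> mx) : continuous f -> f 0 = 1 ->
  (forall t, 0 <= t <= 1 -> isometry (f t)) -> G (f 1).
Proof.
move=> fc f0 fO; apply: (@connected_isometry_Gpq (f @` `[0, 1])).
- apply: connected_continuous_connected; first exact: segment_connected.
  exact: continuous_subspaceT.
- by exists 0 => //; rewrite /= in_itv /= lexx ler01.
- by move=> h [t]; rewrite /= in_itv => t01 <-; exact: fO.
- by exists 1 => //; rewrite /= in_itv /= lexx ler01.
Qed.

(** The image of the connected set [G] is connected, lies in [SO] and meets the component of 1. This
    serves for translations, inversion and conjugation by a reflection. *)
Lemma Gpq_image (f : mx -> mx) g : continuous f -> f @` SO R p q `<=` SO R p q ->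
  G (f 1) -> G g -> G (f g).
Proof.
move=> fc fSO f1 Gg; apply: (connected_component_trans f1).
apply: (@connected_component_max _ _ (f @` G)).
- by exists 1 => //; exact: Gpq1.
- by move=> _ [h Gh <-]; apply: fSO; exists h => //; exact: Gpq_SO.
- apply: connected_continuous_connected; first exact: component_connected.
  exact: continuous_subspaceT.
- by exists g.
Qed.

Lemma SOM g h : SO R p q g -> SO R p q h -> SO R p q (g * h).
Proof.
move=> [gO gd] [hO hd]; split; first exact: isometryM.
by rewrite -mulmxE det_mulmx gd hd mulr1.
Qed.

Lemma SOV g : SO R p q g -> SO R p q (g^-1).
Proof.
move=> [gO gd]; have [_ gu] := isometryV gO; split; last by rewrite det_inv gd invr1.
apply/isometryP => u v; move/isometryP: gO => <-.
by rewrite -!mulr_act mulrV // !mul1mx.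
Qed.

Lemma GpqM g h : G g -> G h -> G (g * h).
Proof.
move=> Gg Gh; refine (@Gpq_image (fun x : mx => g * x) h _ _ _ Gh).
- by apply: continuous_mulmx; [exact: cst_continuous|move=> x; exact: cvg_id].
- by move=> _ [x xSO <-]; apply: SOM => //; exact: Gpq_SO.
- by rewrite mulr1.
Qed.

Lemma GpqV g : G g -> G g^-1.
Proof.
move=> Gg; have [-> _] := isometryV (Gpq_isometry Gg).
refine (@Gpq_image (fun x : mx => J * x^T * J) g _ _ _ Gg).
- apply: continuous_mulmx; last exact: cst_continuous.
  apply: continuous_mulmx; first exact: cst_continuous.
  by apply: continuous_trmx; move=> x; exact: cvg_id.
- by move=> _ [x xSO <-]; have [<- _] := isometryV xSO.1; exact: SOV.
- by rewrite trmx1 mulr1 eta_mx2; exact: Gpq1.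
Qed.

End Conformal.

(** * Plane rotations and Z_G(a) *)

Section PlaneRotations.
Variables (R : realType) (p q : nat).
Local Notation mx := 'M[R]_((p + q).+2).
Local Notation vec := 'cV[R]_((p + q).+2).
Local Notation ix := 'I_((p + q).+2).
Local Notation G := (Gpq R p q).
Local Notation Z := (ZGa R p q).
Local Notation M := (Mpq R p q).
Local Notation D := (D0 R p q).
Local Notation e := (std R).
Local Notation s := (sgn_eta R).
Local Notation eta := Defs.eta.
Implicit Types (g h m : mx) (u v x y : vec) (i j k l : ix) (c t : R).

(* The rotation (or boost, when [s i != s l]) of the plane spanned by
   [e i] and [e l] with [e i |-> c e_i + t e_l]. *)
Definition rot i l c t : mx :=
  1 + (c - 1) *: (delta_mx i i + delta_mx l l) +
  t *: (delta_mx l i - (s i * s l) *: delta_mx i l).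

Lemma delta_mx_act i j v : delta_mx i j *m v = v j ord0 *: e i.
Proof.
apply/matrixP => k o; rewrite ord1 mxE (bigD1 j) //= big1 => [|l lNj].
  by rewrite !mxE !eqxx !andbT addr0 mulrC.
by rewrite mxE (negbTE lNj) andbF mul0r.
Qed.

Lemma rotE i l c t v k : i != l ->
  (rot i l c t *m v) k ord0 =
  if k == i then c * v i ord0 - s i * s l * t * v l ord0
  else if k == l then t * v i ord0 + c * v l ord0 else v k ord0.
Proof.
move=> iNl; rewrite /rot !mulmxDl mul1mx -!scalemxAl !mulmxDl mulNmx -scalemxAl.
rewrite !delta_mx_act !mxE !andbT.
case: (eqVneq k i) => [->|kNi]; first by rewrite (negbTE iNl) /=; ring.
by case: (eqVneq k l) => [->|kNl] /=; ring.
Qed.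

Lemma rot_id i l : rot i l 1 0 = 1.
Proof. by rewrite /rot subrr !scale0r !addr0. Qed.

Lemma rot_isometry i l c t : i != l -> c ^+ 2 + s i * s l * t ^+ 2 = 1 ->
  isometry (rot i l c t).
Proof.
move=> iNl ct; apply/isometryP => u v.
have lNi : l != i by rewrite eq_sym.
rewrite !etaE (bigD1 i) //= (bigD1 l) //= [RHS](bigD1 i) //= [X in _ = _ + X](bigD1 l) //=.
rewrite !addrA; congr (_ + _); last first.
  by apply: eq_bigr => k /andP[kNi kNl]; rewrite !rotE // (negbTE kNi) (negbTE kNl).
rewrite !rotE // eqxx (negbTE lNi) eqxx.
(* The cross terms cancel, and the form of the plane is multiplied by the left side of [ct]. *)
transitivity ((c ^+ 2 + s i * s l * t ^+ 2) *
    (s i * u i ord0 * v i ord0 + s l * u l ord0 * v l ord0)).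
  by case: (sgn_eta_cases R i) (sgn_eta_cases R l) => -> [] ->; ring.
by rewrite ct mul1r.
Qed.

Lemma rot_Gpq i l c t : i != l -> 0 <= c -> c ^+ 2 + s i * s l * t ^+ 2 = 1 ->
  G (rot i l c t).
Proof.
move=> iNl c0 ct.
(* Scale [t] by [r] and let the square root restore the quadratic equation; as [0 <= c], the path
   ends at the given rotation. The radicand is nonnegative on [[0, 1]]: for equal signs
   [t ^+ 2 <= 1], for opposite signs it is at least 1. *)
pose f (r : R) := rot i l (Num.sqrt (1 - s i * s l * (r * t) ^+ 2)) (r * t).
have -> : rot i l c t = f 1.
  by rewrite /f mul1r -ct addrK sqrtr_sqr ger0_norm.
apply: path_Gpq.
- have rt : continuous (fun r : R => r * t).
    by move=> r; apply: cvgM; [exact: cvg_id|exact: cvg_cst].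
  move=> r; apply: cvgD; first apply: cvgD; first exact: cvg_cst.
    apply: cvgZr_tmp; apply: cvgB; last exact: cvg_cst.
    apply: (@continuous_comp _ _ _ (fun r : R => 1 - s i * s l * (r * t) ^+ 2) Num.sqrt).
      apply: cvgB; first exact: cvg_cst.
      by apply: cvgM; [exact: cvg_cst|rewrite expr2; apply: cvgM; exact: rt].
    exact: sqrt_continuous.
  by apply: cvgZr_tmp; exact: rt.
- by rewrite /f mul0r expr0n mulr0 subr0 sqrtr1 rot_id.
move=> r /andP[r0 r1]; apply: rot_isometry => //; rewrite sqr_sqrtr ?subrK //.
have rr : 0 <= r ^+ 2 <= 1 by rewrite sqr_ge0 expr_le1.
have := sqr_ge0 c; have := sqr_ge0 t; move: ct rr; rewrite exprMn.
by case: (sgn_eta_cases R i) (sgn_eta_cases R l) => -> [] ->; nra.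
Qed.

Definition flip i k : mx :=
  diag_mx (\row_j if (j == i) || (j == k) then -1 else 1).

Lemma flipE i k v j :
  (flip i k *m v) j ord0 = (if (j == i) || (j == k) then -1 else 1) * v j ord0.
Proof. by rewrite mul_diag_mx !mxE. Qed.

Lemma mx_coord_inj g h :
  (forall v j, (g *m v) j ord0 = (h *m v) j ord0) -> g = h.
Proof.
move=> gh; apply: mx_std_inj => i; apply/matrixP => j o.
by rewrite ord1 gh.
Qed.

(** A half-turn has [c = -1], outside the range of [rot_Gpq], but it is the square of a
    quarter-turn. *)
Lemma flip_Gpq i k : i != k -> s i = s k -> G (flip i k).
Proof.
move=> iNk sik; have ss : s i * s k = 1 by exact: sgn_eta_eqM.
have kNi : (k == i) = false by rewrite eq_sym (negbTE iNk).
have -> : flip i k = rot i k 0 1 * rot i k 0 1.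
  apply: mx_coord_inj => v j; rewrite mulr_act flipE !rotE // ss.
  case: (eqVneq j i) => [->|jNi] /=; first by rewrite kNi !eqxx; ring.
  by case: (eqVneq j k) => [->|jNk] /=; rewrite ?kNi ?eqxx; ring.
by apply: GpqM; apply: rot_Gpq => //; rewrite ss; ring.
Qed.

(** * The centraliser of [a] and the kernel [M] of its positive characters *)

Lemma ZGaP g : Z g <-> G g /\ g * D = D * g.
Proof.
split=> [[Gg gD]|[Gg gD]]; split => //.
  have := gD (1 *: D) (ex_intro2 _ _ 1 I erefl); rewrite scale1r => {2}<-.
  by rewrite mulrVK // Gpq_unit.
move=> _ [t _ <-]; rewrite -scalerAr gD -scalerAl.
by rewrite mulrK // Gpq_unit.
Qed.

Lemma D0E v k : (D *m v) k ord0 =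
  if k == ord0 then v ord_max ord0 else if k == ord_max then v ord0 ord0 else 0.
Proof.
rewrite mulmxDl !delta_mx_act !mxE !andbT.
case: (eqVneq k ord0) => [->|k0] /=; first by rewrite mulr0 add0r mulr1.
by case: (eqVneq k ord_max) => _; rewrite ?mulr0 ?mulr1 addr0.
Qed.

Lemma ZGa1 : Z 1.
Proof. by apply/ZGaP; split; [exact: Gpq1|rewrite mul1r mulr1]. Qed.

Lemma ZGaM g h : Z g -> Z h -> Z (g * h).
Proof.
move=> /ZGaP[Gg gD] /ZGaP[Gh hD]; apply/ZGaP; split; first exact: GpqM.
by rewrite -mulrA hD mulrA gD mulrA.
Qed.

Lemma ZGaV g : Z g -> Z g^-1.
Proof.
move=> /ZGaP[Gg gD]; apply/ZGaP; split; first exact: GpqV.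
have gu := Gpq_unit Gg.
by apply: (mulrI gu); rewrite !mulrA gD mulrV // mul1r mulrK.
Qed.

Lemma ZGa_unit g : Z g -> g \is a GRing.unit.
Proof. by move=> [/Gpq_unit]. Qed.

Lemma pos_character1 chi : is_pos_character Z chi -> chi 1 = 1.
Proof.
move=> [_ chi0 chiM]; have := chiM 1 1 ZGa1 ZGa1; rewrite mulr1 => c1.
have c0 : chi 1 != 0 by rewrite gt_eqF // chi0 //; exact: ZGa1.
by apply: (mulfI c0); rewrite -c1 mulr1.
Qed.

(** A positive character sends an involution to a positive real of square 1. *)
Lemma Mpq_involution m : Z m -> m * m = 1 -> M m.
Proof.
move=> Zm mm; split => // chi chiP; have chi1 := pos_character1 chiP.
case: chiP => _ chi0 chiM; have := chiM _ _ Zm Zm.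
rewrite mm chi1 => /esym/eqP; rewrite -expr2 sqrf_eq1 => /orP[/eqP //|/eqP cm].
by have := chi0 _ Zm; rewrite cm oppr_gt0 ltr10.
Qed.

Lemma Mpq1 : M 1.
Proof. by apply: Mpq_involution; [exact: ZGa1|rewrite mulr1]. Qed.

Lemma MpqM g h : M g -> M h -> M (g * h).
Proof.
move=> [Zg gM] [Zh hM]; split; first exact: ZGaM.
move=> chi chiP; have [_ _ chiM] := chiP.
by rewrite chiM // gM // hM // mulr1.
Qed.

Lemma MpqV g : M g -> M g^-1.
Proof.
move=> [Zg gM]; have Zg' := ZGaV Zg; split=> // chi chiP; have [_ _ chiM] := chiP.
have := chiM _ _ Zg Zg'; rewrite mulrV ?(pos_character1 chiP) ?gM // ?mul1r //.
exact: ZGa_unit.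
Qed.

Definition inner i := (i != ord0) && (i != ord_max).

Lemma flip_ZGa i k : i != k -> s i = s k -> inner i -> inner k -> Z (flip i k).
Proof.
move=> iNk sik /andP[i0 im] /andP[k0 km]; apply/ZGaP; split; first exact: flip_Gpq.
apply: mx_coord_inj => v j; rewrite !mulr_act flipE !D0E !flipE.
case: (eqVneq j ord0) => [->|_].
  by rewrite ![ord0 == _]eq_sym ![ord_max == _]eq_sym !(negbTE i0, negbTE k0, negbTE im, negbTE km).
case: (eqVneq j ord_max) => [->|_]; last by rewrite mulr0.
by rewrite ![ord0 == _]eq_sym ![ord_max == _]eq_sym !(negbTE i0, negbTE k0, negbTE im, negbTE km).
Qed.

End PlaneRotations.

(** * Elimination by plane rotations *)

Section Elimination.
Variables (R : realType) (p q : nat).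
Hypothesis d_gt2 : (2 < p + q)%N.
Local Notation mx := 'M[R]_((p + q).+2).
Local Notation vec := 'cV[R]_((p + q).+2).
Local Notation ix := 'I_((p + q).+2).
Local Notation G := (Gpq R p q).
Local Notation Z := (ZGa R p q).
Local Notation M := (Mpq R p q).
Local Notation D := (D0 R p q).
Local Notation e := (std R).
Local Notation s := (sgn_eta R).
Local Notation eta := Defs.eta.
Implicit Types (g h m : mx) (u v x y f : vec) (i j k l : ix) (c t : R).

(** This is where [d > 2] enters: at most four indices are excluded, and there are [d + 2 >= 5]. *)
Lemma third_inner i l : exists k, [/\ inner k, k != i & k != l].
Proof.
pose B : {set ix} := [set ord0; ord_max; i; l]%SET.
have : (#|B| < #|{: ix}|)%N.
  rewrite card_ord (leq_ltn_trans (leq_card_setU _ _)) // cards1 addn1 ltnS.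
  rewrite (leq_ltn_trans (leq_card_setU _ _)) // cards1 addn1 ltnS.
  by rewrite (leq_ltn_trans (leq_card_setU _ _)) // !cards1.
rewrite -cardsT -subn_gt0 -cardsDS ?subsetT // card_gt0 => /set0Pn[k].
rewrite !inE andbT !negb_or => /andP[/andP[/andP[k0 km] ki] kl].
by exists k; rewrite /inner k0 km ki kl.
Qed.

(* For [s i] and [s k] of opposite signs, [flip i k] has to be completed by -1
   on the plane of [D0], which still commutes with [D0]. *)
Lemma exists_ZGa_sign i l : inner i -> inner l -> i != l ->
  exists g (d : ix -> R), [/\ Z g, forall v j, (g *m v) j ord0 = d j * v j ord0,
    forall j, d j * d j = 1 & d i * d l = -1].
Proof.
move=> Ii Il iNl; have [k [Ik kNi kNl]] := third_inner i l.
have lNi : l != i by rewrite eq_sym.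
have iNk : i != k by rewrite eq_sym.
have lNk : l != k by rewrite eq_sym.
have [sik|sik] := eqVneq (s i) (s k).
  exists (flip R i k), (fun j => if (j == i) || (j == k) then -1 else 1).
  split; [exact: flip_ZGa|exact: flipE|by move=> j; case: ifP => _; ring|].
  by rewrite eqxx (negbTE lNi) (negbTE lNk) mulr1.
have [slk|slk] := eqVneq (s l) (s k).
  exists (flip R l k), (fun j => if (j == l) || (j == k) then -1 else 1).
  split; [exact: flip_ZGa|exact: flipE|by move=> j; case: ifP => _; ring|].
  by rewrite eqxx (negbTE iNl) (negbTE iNk) mul1r.
(* Now [k] has the sign opposite to that of [i] and [l]. The indices [ord0] and [ord_max] carry both
   signs, so one of them can be paired with [i] and the other with [k]. *)
have [a [b [sa sb ab]]] : exists a b : ix, [/\ s i = s a, s k = s b &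
    (a = ord0 /\ b = ord_max) \/ (a = ord_max /\ b = ord0)].
  have := sgn_eta0 R p q; have := sgn_eta_max R p q.
  case: (sgn_eta_cases R i) (sgn_eta_cases R k) sik => -> [] ->; rewrite ?eqxx // => _ sm s0.
    by exists ord0, ord_max; rewrite sm s0; split => //; left.
  by exists ord_max, ord0; rewrite sm s0; split => //; right.
have [[iNa iNb kNa kNb lNa] lNb] : [/\ i != a, i != b, k != a, k != b & l != a] /\ l != b.
  case/andP: Ii => ? ?; case/andP: Ik => ? ?; case/andP: Il => ? ?.
  by case: ab => -[-> ->].
pose d1 j : R := if (j == i) || (j == a) then -1 else 1.
pose d2 j : R := if (j == k) || (j == b) then -1 else 1.
have gE v j : (flip R i a * flip R k b *m v) j ord0 = d1 j * d2 j * v j ord0.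
  by rewrite mulr_act !flipE mulrA.
exists (flip R i a * flip R k b), (fun j => d1 j * d2 j); split => //.
- apply/ZGaP; split; first by apply: GpqM; exact: flip_Gpq.
  apply: mx_coord_inj => v j; rewrite [LHS](_ : _ = d1 j * d2 j * (D *m v) j ord0); last first.
    by rewrite mulr_act gE.
  rewrite mulr_act !D0E !gE.
  (* Commuting with [D0], which exchanges the two coordinates of its plane, amounts to equal signs
     there. *)
  have dm : d1 ord0 * d2 ord0 = d1 ord_max * d2 ord_max.
    case/andP: Ii => i0 im; case/andP: Ik => k0 km.
    rewrite /d1 /d2 ![_ == i]eq_sym ![_ == k]eq_sym.
    rewrite (negbTE i0) (negbTE im) (negbTE k0) (negbTE km) /=.
    have om : (ord0 == ord_max :> ix) = false by [].
    have mo : (ord_max == ord0 :> ix) = false by [].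
    by case: ab => -[-> ->]; rewrite !eqxx ?om ?mo; ring.
  case: (eqVneq j ord0) => [->|_]; first by rewrite dm.
  by case: (eqVneq j ord_max) => [->|_]; rewrite ?dm ?mulr0.
- by move=> j; rewrite /d1 /d2; do 2!case: ifP => _; ring.
rewrite /d1 /d2 eqxx (negbTE iNk) (negbTE iNb) (negbTE lNi) (negbTE lNa).
by rewrite (negbTE lNk) (negbTE lNb) /= !mulr1.
Qed.

(* The rotation is the product of the involutions [g] and [g * rot i l c t]. *)
Lemma rot_Mpq i l c t : inner i -> inner l -> i != l -> 0 <= c ->
  c ^+ 2 + s i * s l * t ^+ 2 = 1 -> M (rot i l c t).
Proof.
move=> Ii Il iNl c0 ct; have [g [d [Zg gE dd dil]]] := exists_ZGa_sign Ii Il iNl.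
have lNi : (l == i) = false by rewrite eq_sym (negbTE iNl).
have gg : g * g = 1.
  by apply: mx_coord_inj => v j; rewrite mulr_act !gE mulrA dd mul1r mul1mx.
have Zr : Z (rot i l c t).
  apply/ZGaP; split; first exact: rot_Gpq.
  case/andP: Ii => i0 im; case/andP: Il => l0 lm.
  have ne (a b : ix) : a != b -> ((a == b) = false) * ((b == a) = false).
    by move=> ab; rewrite [b == a]eq_sym (negbTE ab).
  apply: mx_coord_inj => v j; rewrite !mulr_act D0E !rotE // !D0E.
  rewrite !(ne _ _ i0, ne _ _ im, ne _ _ l0, ne _ _ lm).
  case: (eqVneq j i) => [->|_].
    by rewrite !(ne _ _ i0, ne _ _ im); ring.
  by case: (eqVneq j l) => [->|_] //; rewrite !(ne _ _ l0, ne _ _ lm); ring.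
have -> : rot i l c t = g * (g * rot i l c t) by rewrite mulrA gg mul1r.
apply: MpqM; first exact: Mpq_involution.
apply: Mpq_involution; first exact: ZGaM.
(* As [d i] and [d l] are opposite, conjugation by [g] inverts the rotation, so the product with [g]
   squares to 1. In coordinates the cross terms vanish and [ct] remains. *)
apply: mx_coord_inj => v j; rewrite mul1mx !mulr_act gE rotE // !gE !rotE //.
rewrite !eqxx lNi.
have di := dd i; have dl := dd l; have dj := dd j.
case: (eqVneq j i) => [->|_].
  transitivity (d i * d i * c ^+ 2 * v i ord0 - (d i * d l) * (s i * s l * t ^+ 2) * v i ord0
     - (d i * d i + d i * d l) * (s i * s l * c * t) * v l ord0); first by ring.
  by rewrite di dil -[RHS]mul1r -[in RHS]ct; ring.
case: (eqVneq j l) => [->|_]; last by rewrite mulrA dj mul1r.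
transitivity (d l * d l * c ^+ 2 * v l ord0 - (d i * d l) * (s i * s l * t ^+ 2) * v l ord0
     + (d l * d l + d i * d l) * (c * t) * v i ord0); first by ring.
by rewrite dl dil -[RHS]mul1r -[in RHS]ct; ring.
Qed.

(** The rotation is read off from the coordinates of [f] in the plane, normalised by the square root
    of [Q]; positivity of [Q] makes this possible even for a boost. *)
Lemma kill_coord i l f : inner i -> inner l -> i != l ->
  0 < f i ord0 ^+ 2 + s i * s l * f l ord0 ^+ 2 ->
  exists m, [/\ M m, (m *m f) l ord0 = 0,
    forall v j, j != i -> j != l -> (m *m v) j ord0 = v j ord0 &
    forall v, v i ord0 = 0 -> v l ord0 = 0 -> m *m v = v].
Proof.
move=> Ii Il iNl; set Q := _ + _ => Q0.
have r0 : 0 < Num.sqrt Q by rewrite sqrtr_gt0.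
have r2 : Num.sqrt Q ^+ 2 = Q by rewrite sqr_sqrtr // ltW.
have rN0 : Num.sqrt Q != 0 by rewrite gt_eqF.
have lNi : (l == i) = false by rewrite eq_sym (negbTE iNl).
(* The sign [b] makes [c] nonnegative, as [rot_Mpq] requires. *)
pose b : R := if 0 <= f i ord0 then 1 else -1.
have bb : b * b = 1 by rewrite /b; case: ifP => _; ring.
pose c := b * f i ord0 / Num.sqrt Q; pose t := - b * f l ord0 / Num.sqrt Q.
exists (rot i l c t); split.
- apply: rot_Mpq => //.
    rewrite divr_ge0 ?sqrtr_ge0 // /b; case: ifP => [|/negbT]; first by rewrite mul1r.
    by rewrite -ltNge mulN1r oppr_ge0 => /ltW.
  transitivity ((b * b) * Q / Num.sqrt Q ^+ 2); first by rewrite /c /t /Q; field.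
  by rewrite bb r2 mul1r divff // gt_eqF.
- by rewrite rotE // lNi eqxx /c /t; ring.
- by move=> v j ji jl; rewrite rotE // (negbTE ji) (negbTE jl).
move=> v vi vl; apply/matrixP => j o; rewrite ord1 rotE // vi vl.
case: (eqVneq j i) => [->|_]; first by rewrite vi; ring.
by case: (eqVneq j l) => [->|_] //; rewrite vl; ring.
Qed.

(** [B] collects the directions to be left fixed. By induction on the number of nonzero coordinates
    of [f] away from [i], plane rotations kill them one at a time; the norm of [f] then forces the
    last coordinate to be 1 or -1. *)
Lemma reduce_col (B : {set ix}) i f : ord0 \in B -> ord_max \in B -> i \notin B ->
  (forall j, j \in B -> f j ord0 = 0) -> eta f f = s i ->
  exists m, [/\ M m, forall j, j \in B -> m *m e j = e j &
    m *m f = e i \/ m *m f = - e i].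
Proof.
move=> B0 Bm iB; have innerB j : j \notin B -> inner j.
  by move=> jB; apply/andP; split; apply: contraNneq jB => ->.
move: {2}#|_| (leqnn #|[set j | (j != i) && (f j ord0 != 0)]%SET|) => n.
elim: n f => [|n IH] f fn fB ff.
  have f0 j : j != i -> f j ord0 = 0.
    move=> ji; move: fn; rewrite leqn0 cards_eq0 => /eqP/setP/(_ j).
    by rewrite !inE ji /= => /negbFE/eqP.
  have fE : f = f i ord0 *: e i.
    apply/matrixP => j o; rewrite ord1 mxE stdE.
    by case: eqVneq => [->|/f0 ->]; rewrite ?mulr1 ?mulr0.
  have /eqP : f i ord0 ^+ 2 = 1.
    move: ff; rewrite {1 2}fE etaZl etaZr eta_std stdE eqxx mulr1.
    rewrite mulrA -expr2 => ff.
    by apply: (mulIf (sgn_eta_neq0 R i)); rewrite ff mul1r.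
  rewrite sqrf_eq1 => fi; exists 1; split; [exact: Mpq1|by move=> j _; rewrite mul1mx|].
  by rewrite mul1mx fE; case/orP: fi => /eqP ->; [left; rewrite scale1r|right; rewrite scaleN1r].
have [f0|[l0 l0P]] := set_0Vmem [set j | (j != i) && (f j ord0 != 0)]%SET.
  by apply: IH => //; rewrite f0 cards0.
(* If some nonzero coordinate has the sign of [i], the expression is a sum of squares. Otherwise all
   the other nonzero coordinates have the opposite sign, and [eta f f = s i] gives
   [f i ^+ 2 - f l ^+ 2 >= 1]. *)
have [l [lNi fl Q]] : exists l, [/\ l != i, f l ord0 != 0 &
    0 < f i ord0 ^+ 2 + s i * s l * f l ord0 ^+ 2].
  have [/existsP[l /and3P[lNi fl /eqP sil]]|/existsPn noth] :=
      boolP [exists l, [&& l != i, f l ord0 != 0 & s i == s l]].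
    exists l; split=> //; rewrite (sgn_eta_eqM sil) mul1r.
    by rewrite ltr_wpDl ?sqr_ge0 // lt_def sqr_ge0 sqrf_eq0 fl.
  move: l0P; rewrite inE => /andP[l0i fl0]; exists l0; split => //.
  have sl j : j != i -> f j ord0 != 0 -> s i != s j.
    by move=> ji fj; have := noth j; rewrite ji fj.
  rewrite (sgn_eta_neqM (sl _ l0i fl0)).
  have : s i * eta f f = 1 by rewrite ff sgn_etaM.
  rewrite etaE (bigD1 i) //= (bigD1 l0) //= !mulrDr mulr_sumr !mulrA sgn_etaM.
  rewrite (sgn_eta_neqM (sl _ l0i fl0)).
  have : \sum_(j | (j != i) && (j != l0)) s i * (s j * f j ord0 * f j ord0) <= 0.
    apply: sumr_le0 => j /andP[ji _].
    have [->|fj] := eqVneq (f j ord0) 0; first by rewrite !mulr0.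
    rewrite !mulrA (sgn_eta_neqM (sl _ ji fj)) -mulrA mulN1r oppr_le0.
    by rewrite -expr2 sqr_ge0.
  by move: (\sum_(_ | _) _) => S; nra.
have lB : l \notin B by apply: contraNN fl => /fB ->.
have iNl : i != l by rewrite eq_sym.
have [m [Mm ml mj mv]] := kill_coord (innerB _ iB) (innerB _ lB) iNl Q.
have Bne j : j \in B -> j != i /\ j != l.
  by move=> jB; split; apply: contraTneq jB => ->.
have [|||m' [Mm' m'B m'f]] := IH (m *m f).
- rewrite -ltnS (leq_trans _ fn) //; apply: proper_card.
  apply/properP; split.
    apply/fintype.subsetP => j; rewrite !inE => /andP[ji]; rewrite ji /=.
    by have [->|jl] := eqVneq j l; rewrite ?ml ?eqxx // mj.
  by exists l; rewrite !inE ?lNi ?fl // ml eqxx andbF.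
- by move=> j jB; have [ji jl] := Bne _ jB; rewrite mj // fB.
- by case: Mm => -[Gm _] _; rewrite Gpq_eta.
exists (m' * m); split; first exact: MpqM; last by rewrite mulr_act.
move=> j jB; have [ji jl] := Bne _ jB; rewrite mulr_act mv ?m'B //.
  by rewrite stdE eq_sym (negbTE ji).
by rewrite stdE eq_sym (negbTE jl).
Qed.

(** Multiplying by elements of [M] turns the columns into signed basis vectors one after another;
    the diagonal sign matrix that is left is an involution, hence in [M]. *)
Lemma ZGa_sign_Mpq m : Z m ->
  m *m e ord0 = e ord0 \/ m *m e ord0 = - e ord0 ->
  m *m e ord_max = e ord_max \/ m *m e ord_max = - e ord_max -> M m.
Proof.
move=> Zm m0 mm.
(* [B] is the set of columns already reduced; the induction is on a bound for its complement. *)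
suff H (n : nat) (B : {set ix}) g : (#|~: B|%SET <= n)%N -> ord0 \in B -> ord_max \in B -> Z g ->
    (forall j, j \in B -> g *m e j = e j \/ g *m e j = - e j) -> M g.
  apply: (H #|~: [set ord0; ord_max : ix]|%SET [set ord0; ord_max]%SET) => //;
    rewrite ?inE ?eqxx ?orbT //.
  by move=> j; rewrite !inE => /orP[] /eqP ->.
elim: n B g => [|n IH] B g Bn B0 Bm Zg gB.
  apply: Mpq_involution => //; apply: mx_std_inj => j; rewrite mulr_act mul1mx.
  have /gB[gj|gj] : j \in B.
    by move: Bn; rewrite leqn0 cards_eq0 => /eqP/setP/(_ j); rewrite !inE => /negbFE.
  - by rewrite !gj.
  - by rewrite gj mulmxN gj opprK.
have [B1|[i]] := set_0Vmem (~: B)%SET; first by apply: (IH B) => //; rewrite B1 cards0.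
rewrite inE => iB; have Gg := Zg.1.
have [||m' [Mm' m'B m'f]] := @reduce_col B i (g *m e i) B0 Bm iB.
(* Column [i] is orthogonal to the columns in [B], which are signed basis vectors, so its
   coordinates in [B] vanish. *)
- move=> j jB; have ji : j != i by apply: contraTneq jB => ->.
  have : eta (g *m e j) (g *m e i) = 0.
    by rewrite Gpq_eta // eta_std stdE (negbTE ji) mulr0.
  case: (gB _ jB) => ->; rewrite ?etaNl eta_std => /eqP;
    by rewrite ?oppr_eq0 mulf_eq0 (negbTE (sgn_eta_neq0 R j)) => /eqP.
- by rewrite Gpq_eta // eta_std stdE eqxx mulr1.
have gE : g = m'^-1 * (m' * g) by rewrite mulKr // ZGa_unit //; case: Mm'.
rewrite gE; apply: MpqM; first exact: MpqV.
apply: (IH (i |: B)%SET).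
- rewrite -ltnS (leq_trans _ Bn) //; apply: proper_card; apply/properP; split.
    by apply/fintype.subsetP => j; rewrite !inE negb_or => /andP[].
  by exists i; rewrite !inE // eqxx.
- by rewrite inE B0 orbT.
- by rewrite inE Bm orbT.
- by apply: ZGaM => //; case: Mm'.
move=> j; rewrite !inE mulr_act => /orP[/eqP -> //|jB].
by case: (gB _ jB) => ->; rewrite ?mulmxN m'B //; [left|right].
Qed.

End Elimination.

(** * The decomposition Z_G(a) = MA and the symmetric subgroup *)

Section Levi.
Variables (R : realType) (p q : nat).
Local Notation mx := 'M[R]_((p + q).+2).
Local Notation vec := 'cV[R]_((p + q).+2).
Local Notation ix := 'I_((p + q).+2).
Local Notation G := (Gpq R p q).
Local Notation Z := (ZGa R p q).
Local Notation M := (Mpq R p q).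
Local Notation A := (Apq R p q).
Local Notation D := (D0 R p q).
Local Notation e := (std R).
Local Notation eta := Defs.eta.
Implicit Types (g h m : mx) (u v x y : vec) (i j k : ix) (c t : R).

(** * Null eigenvectors of [D0] and the action of the centraliser on them *)

Definition kplus : vec := e ord0 + e ord_max.
Definition kminus : vec := e ord0 - e ord_max.
Local Notation kp := kplus.
Local Notation km := kminus.

Lemma ord0_max : (ord0 == ord_max :> ix) = false. Proof. by []. Qed.
Lemma ord_max0 : (ord_max == ord0 :> ix) = false. Proof. by []. Qed.

Lemma std0E : e ord0 = 2^-1 *: (kp + km).
Proof. by apply/matrixP => i j; rewrite !mxE; field. Qed.

Lemma stdmaxE : e ord_max = 2^-1 *: (kp - km).
Proof. by apply/matrixP => i j; rewrite !mxE; field. Qed.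

Lemma D0_std0 : D *m e ord0 = e ord_max.
Proof.
apply/matrixP => i o; rewrite ord1 D0E !stdE eqxx ord_max0.
by case: (eqVneq i ord0) => [->|_] //; case: (eqVneq i ord_max).
Qed.

Lemma D0_stdmax : D *m e ord_max = e ord0.
Proof.
apply/matrixP => i o; rewrite ord1 D0E !stdE eqxx ord0_max.
by case: (eqVneq i ord0) => [_|_] //; case: (eqVneq i ord_max).
Qed.

Lemma D0_inner i : inner i -> D *m e i = 0.
Proof.
case/andP => i0 im; apply/matrixP => j o; rewrite ord1 D0E !stdE mxE.
rewrite [_ == i]eq_sym (negbTE im) [_ == i]eq_sym (negbTE i0).
by case: ifP => // _; case: ifP.
Qed.

Lemma D0_kplus : D *m kp = kp.
Proof. by rewrite mulmxDr D0_std0 D0_stdmax addrC. Qed.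

Lemma D0_kminus : D *m km = - km.
Proof. by rewrite mulmxBr D0_std0 D0_stdmax opprB. Qed.

(* The eigenvectors of D0 for 1, -1, 0 span. *)
Lemma mx_levi_inj g h : g *m kp = h *m kp -> g *m km = h *m km ->
  (forall i, inner i -> g *m e i = h *m e i) -> g = h.
Proof.
move=> ghp ghm ghi; apply: mx_std_inj => i.
have [->|i0] := eqVneq i ord0; first by rewrite std0E -!scalemxAr !(mulmxDr _ kp) ghp ghm.
have [->|im] := eqVneq i ord_max; first by rewrite stdmaxE -!scalemxAr !(mulmxBr _ kp) ghp ghm.
by apply: ghi; rewrite /inner i0 im.
Qed.

Lemma eta_kplus v : eta kp v = v ord0 ord0 - v ord_max ord0.
Proof. by rewrite etaDl !eta_std sgn_eta0 sgn_eta_max mul1r mulN1r. Qed.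

Lemma eta_kminus v : eta km v = v ord0 ord0 + v ord_max ord0.
Proof. by rewrite etaDl etaNl !eta_std sgn_eta0 sgn_eta_max mul1r mulN1r opprK. Qed.

Lemma kplus0 : kp ord0 ord0 = 1.
Proof. by rewrite mxE !stdE eqxx ord0_max addr0. Qed.

Lemma kplusmax : kp ord_max ord0 = 1.
Proof. by rewrite mxE !stdE eqxx ord_max0 add0r. Qed.

Lemma kminus0 : km ord0 ord0 = 1.
Proof. by rewrite !mxE !eqxx ord0_max subr0. Qed.

Lemma kminusmax : km ord_max ord0 = -1.
Proof. by rewrite !mxE !eqxx ord_max0 sub0r. Qed.

Lemma eta_kpp : eta kp kp = 0.
Proof. by rewrite eta_kplus kplus0 kplusmax subrr. Qed.

Lemma eta_kmm : eta km km = 0.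
Proof. by rewrite eta_kminus kminus0 kminusmax subrr. Qed.

Lemma eta_kpm : eta kp km = 2.
Proof. by rewrite eta_kplus kminus0 kminusmax opprK. Qed.

Lemma D0_fixE x : D *m x = x -> x = x ord0 ord0 *: kp.
Proof.
move=> Dx; have xE j : x j ord0 = (D *m x) j ord0 by rewrite Dx.
have xm : x ord_max ord0 = x ord0 ord0 by rewrite xE D0E eqxx ord_max0.
apply/matrixP => i o; rewrite ord1 [LHS]xE D0E [RHS]mxE [kp i _]mxE !stdE.
case: (eqVneq i ord0) => [->|_]; first by rewrite ord0_max addr0 mulr1.
by case: (eqVneq i ord_max) => _ /=; ring.
Qed.

Lemma D0_antifixE x : D *m x = - x -> x = x ord0 ord0 *: km.
Proof.
move=> Dx; have xE j : x j ord0 = - (D *m x) j ord0 by rewrite Dx mxE opprK.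
have xm : x ord_max ord0 = - x ord0 ord0 by rewrite xE D0E eqxx ord_max0.
apply/matrixP => i o; rewrite ord1 [LHS]xE D0E [RHS]mxE [km i _]mxE [(- e _) i _]mxE !stdE.
case: (eqVneq i ord0) => [->|_]; first by rewrite ord0_max xm opprK subr0 mulr1.
by case: (eqVneq i ord_max) => _ /=; ring.
Qed.

(** Commuting with [D0] preserves its eigenlines for 1 and -1; the pairing [eta kp km = 2] is
    preserved too, so the two scalars are inverse to each other. *)
Lemma ZGa_eigen g : Z g -> exists lam,
  [/\ lam != 0, g *m kp = lam *: kp & g *m km = lam^-1 *: km].
Proof.
move=> /ZGaP[Gg gD].
have gp : g *m kp = (g *m kp) ord0 ord0 *: kp.
  by apply: D0_fixE; rewrite -mulr_act -gD mulr_act D0_kplus.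
have gm : g *m km = (g *m km) ord0 ord0 *: km.
  by apply: D0_antifixE; rewrite -mulr_act -gD mulr_act D0_kminus mulmxN.
have := Gpq_eta kp km Gg; rewrite gp gm etaZl etaZr eta_kpm.
move: ((g *m kp) _ _) ((g *m km) _ _) gp gm => lam mu gp gm lm.
have {}lm : lam * mu = 1 by lra.
have l0 : lam != 0 by case: eqP lm => // ->; rewrite mul0r => /esym/eqP; rewrite oner_eq0.
exists lam; split => //; rewrite ?gm; congr (_ *: _).
by apply: (mulfI l0); rewrite lm divff.
Qed.

(** * Powers and exponentials of multiples of [D0] *)

Lemma D03 : D * D * D = D.
Proof.
apply: mx_levi_inj => [||i Ii]; rewrite !mulr_act ?D0_kplus ?D0_kminus //.
  by rewrite mulmxN D0_kminus opprK D0_kminus.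
by rewrite !D0_inner // !mulmx0.
Qed.

(** Spectral projections of [D0] for the eigenvalues 1 and -1; the one for 0 is [1 - D * D]. *)
Local Notation Ep := (2^-1 *: (D * D + D)).
Local Notation Em := (2^-1 *: (D * D - D)).

(** The last term is present only at [n = 0], where [0 ^+ 0 = 1]. *)
Lemma D0_pow t n : (t *: D) ^+ n =
  t ^+ n *: Ep + (- t) ^+ n *: Em + 0 ^+ n *: (1 - D * D).
Proof.
elim: n => [|n IH].
  rewrite !expr0; move: (D * D) => P.
  by apply/matrixP => i j; rewrite !mxE; field.
have DEp : D * Ep = Ep by rewrite -scalerAr mulrDr mulrA D03 addrC.
have DEm : D * Em = - Em by rewrite -scalerAr mulrBr mulrA D03 -scalerN opprB.
have DE0 : D * (1 - D * D) = 0 by rewrite mulrBr mulr1 mulrA D03 subrr.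
move: Ep Em (1 - D * D) DEp DEm DE0 IH => E1 E2 E3 DEp DEm DE0 IH.
rewrite exprS IH -scalerAl !mulrDr -!scalerAr DEp DEm DE0 scaler0 addr0.
by rewrite expr0n scale0r addr0 !exprS scalerDr !scalerA mulNr scaleNr -scalerN.
Qed.

(** Along each spectral projection the matrix series is a scalar exponential series, at [t], [- t]
    and 0. *)
Lemma mexp_D0 t : mexp (t *: D) =
  expR t *: Ep + expR (- t) *: Em + (1 - D * D).
Proof.
have cvg_exp r (B : mx) : series (exp_coeff r) n *: B @[n --> \oo] --> expR r *: B.
  by apply: cvgZr_tmp; exact: is_cvg_series_exp_coeff.
apply/cvg_lim => //.
have -> : series (fun a => (a`!%:R)^-1 *: (t *: D) ^+ a) = fun n =>
    series (exp_coeff t) n *: Ep + series (exp_coeff (- t)) n *: Em +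
    series (exp_coeff 0) n *: (1 - D * D).
  apply/funext => n; rewrite /series /= !scaler_suml -!big_split /=.
  apply: eq_bigr => a _; rewrite D0_pow /exp_coeff /=.
  move: Ep Em (1 - D * D) => E1 E2 E3.
  by rewrite !scalerDr !scalerA ![_^-1 * _]mulrC.
rewrite -[X in _ + _ + X]scale1r -expR0.
by apply: cvgD; [apply: cvgD|]; exact: cvg_exp.
Qed.

Lemma mexp_D0_act t v : mexp (t *: D) *m v =
  expR t *: (2^-1 *: (D *m (D *m v) + D *m v)) +
  expR (- t) *: (2^-1 *: (D *m (D *m v) - D *m v)) + (v - D *m (D *m v)).
Proof.
rewrite mexp_D0 2!mulmxDl -!scalemxAl (mulmxDl (D * D)) (mulmxBl (D * D)).
by rewrite (mulmxBl 1) mul1mx !mulr_act.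
Qed.

Lemma mexp_D0_kplus t : mexp (t *: D) *m kp = expR t *: kp.
Proof.
rewrite mexp_D0_act !D0_kplus.
by move: (kp) => v; apply/matrixP => i j; rewrite !mxE; field.
Qed.

Lemma mexp_D0_kminus t : mexp (t *: D) *m km = expR (- t) *: km.
Proof.
rewrite mexp_D0_act !(D0_kminus, mulmxN).
by move: (km) => v; apply/matrixP => i j; rewrite !mxE; field.
Qed.

Lemma mexp_D0_ZGa t : Z (mexp (t *: D)).
Proof.
apply/ZGaP; split; last first.
  apply: mx_levi_inj => [||i Ii]; rewrite !mulr_act.
  - by rewrite D0_kplus mexp_D0_kplus -scalemxAr D0_kplus.
  - by rewrite D0_kminus mulmxN mexp_D0_kminus -scalemxAr D0_kminus scalerN.
  rewrite D0_inner // mulmx0 mexp_D0_act !(D0_inner Ii, mulmx0).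
  by rewrite !(addr0, oppr0, scaler0, add0r) D0_inner.
(* [c] and [r] are the hyperbolic cosine and sine of [t]: the exponential is a boost in the plane of
   [D0]. *)
pose c := 2^-1 * (expR t + expR (- t)); pose r := 2^-1 * (expR t - expR (- t)).
have sE : sgn_eta R (ord0 : ix) * sgn_eta R (ord_max : ix) = -1.
  by rewrite sgn_eta0 sgn_eta_max mul1r.
have -> : mexp (t *: D) = rot ord0 ord_max c r.
  apply: mx_coord_inj => v j; rewrite rotE // sE.
  rewrite mexp_D0_act; move: (D0E v) (D0E (D *m v)).
  move: (D *m (D *m v)) => y; move: (D *m v) => x xE yE; rewrite !mxE !(xE, yE).
  rewrite !eqxx ord_max0 /c /r.
  case: (eqVneq j ord0) => [->|_]; first by field.
  by case: (eqVneq j ord_max) => [->|_]; field.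
apply: rot_Gpq => //; first by rewrite mulr_ge0 ?invr_ge0 // addr_ge0 // expR_ge0.
rewrite sE; transitivity (expR t * expR (- t)); first by rewrite /c /r; field.
by rewrite -expRD subrr expR0.
Qed.

Lemma ApqP g : A g <-> exists t, g = mexp (t *: D).
Proof.
split=> [[_ [t _ <-] <-]|[t ->]]; first by exists t.
by exists (t *: D) => //; exists t.
Qed.

Lemma Apq_ZGa g : A g -> Z g.
Proof. by move/ApqP => [t ->]; exact: mexp_D0_ZGa. Qed.

(** If [g] scales [kp] by [lam], dividing by the element of [A] with parameter [ln |lam|] leaves the
    scalar [lam / |lam|] on both [kp] and [km]. The quotient thus acts by one sign on the plane of
    [D0], and [ZGa_sign_Mpq] applies. *)
Lemma MApqE : (2 < p + q)%N -> MApq R p q = Z.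
Proof.
move=> d_gt2; apply/seteqP; split => [_ [m [Zm _] [a /Apq_ZGa Za <-]]|g Zg].
  exact: ZGaM.
have [lam [l0 gp gm]] := ZGa_eigen Zg.
have l_gt0 : 0 < `|lam| by rewrite normr_gt0.
pose a : mx := mexp (ln `|lam| *: D).
have Za : Z a by exact: mexp_D0_ZGa.
have au := ZGa_unit Za.
have lN0 : `|lam| != 0 by rewrite normr_eq0.
have aVp : a^-1 *m kp = `|lam|^-1 *: kp.
  apply: (scalerI lN0); rewrite scalerA divff // scale1r scalemxAr.
  have <- : a *m kp = `|lam| *: kp by rewrite mexp_D0_kplus lnK.
  by rewrite -mulr_act mulVr // mul1mx.
have aVm : a^-1 *m km = `|lam| *: km.
  apply: (scalerI (invr_neq0 lN0)); rewrite scalerA mulVf // scale1r scalemxAr.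
  have <- : a *m km = `|lam|^-1 *: km by rewrite mexp_D0_kminus expRN lnK.
  by rewrite -mulr_act mulVr // mul1mx.
exists (g * a^-1); last by exists a; [apply/ApqP; exists (ln `|lam|)|rewrite mulrVK].
have mp : (g * a^-1) *m kp = (lam / `|lam|) *: kp.
  by rewrite mulr_act aVp -scalemxAr gp scalerA mulrC.
have mm : (g * a^-1) *m km = (lam^-1 * `|lam|) *: km.
  by rewrite mulr_act aVm -scalemxAr gm scalerA mulrC.
have Zm : Z (g * a^-1) by apply: ZGaM => //; exact: ZGaV.
move: l0 mp mm; have [lgt|] := ltP 0 lam.
  rewrite gtr0_norm // => l0; rewrite divff // mulVf // !scale1r => mp mm.
  apply: ZGa_sign_Mpq => //; left.
    by rewrite std0E -scalemxAr mulmxDr mp mm.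
  by rewrite stdmaxE -scalemxAr mulmxBr mp mm.
move=> l_le l0; rewrite ler0_norm // invrN !mulrN divff // mulVf // !scaleN1r => mp mm.
apply: ZGa_sign_Mpq => //; right.
  by rewrite std0E -scalemxAr mulmxDr mp mm -opprD scalerN.
by rewrite stdmaxE -scalemxAr mulmxBr mp mm -opprD scalerN.
Qed.

(** * The involution of [G] by conjugation with the reflection [S], and its fixed points *)

Local Notation S := (1 - 2 *: (D * D)).

Lemma reflection_act v : S *m v = v - 2 *: (D *m (D *m v)).
Proof. by rewrite mulmxBl mul1mx -scalemxAl mulr_act. Qed.

Lemma reflectionE v j :
  (S *m v) j ord0 = (if (j == ord0) || (j == ord_max) then -1 else 1) * v j ord0.
Proof.
rewrite reflection_act; move: (D0E v) (D0E (D *m v)).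
move: (D *m (D *m v)) => y; move: (D *m v) => x xE yE; rewrite !mxE yE !xE.
rewrite !eqxx ord_max0.
case: (eqVneq j ord0) => [->|_] /=; first by ring.
by case: (eqVneq j ord_max) => [->|_] /=; ring.
Qed.

Lemma reflection_sqr : S * S = 1.
Proof.
apply: mx_coord_inj => v j; rewrite mulr_act !reflectionE mul1mx.
by case: ifP => _; ring.
Qed.

Lemma reflection_isometry : isometry S.
Proof.
apply/isometryP => u v; rewrite !etaE; apply: eq_bigr => j _; rewrite !reflectionE.
by case: ifP => _; ring.
Qed.

Lemma conj_reflection_SO g : SO R p q g -> SO R p q (S * g * S).
Proof.
move=> [gO gd]; split.
  by apply: isometryM; [apply: isometryM|]; rewrite //; exact: reflection_isometry.
rewrite -!mulmxE !det_mulmx gd mulr1 -det_mulmx mulmxE reflection_sqr.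
exact: det1.
Qed.

Lemma continuous_conj_reflection : continuous (fun g : mx => S * g * S).
Proof.
apply: continuous_mulmx; last exact: cst_continuous.
by apply: continuous_mulmx; [exact: cst_continuous|move=> x; exact: cvg_id].
Qed.

Lemma conj_reflection_involution : is_involution G (fun g => S * g * S).
Proof.
split.
- exact/continuous_subspaceT/continuous_conj_reflection.
- move=> g Gg; refine (@Gpq_image _ _ _ (fun g : mx => S * g * S) g _ _ _ Gg).
  + exact: continuous_conj_reflection.
  + by move=> _ [h hSO <-]; exact: conj_reflection_SO.
  + by rewrite mulr1 reflection_sqr; exact: Gpq1.
- move=> g h _ _ /=; move: (S) reflection_sqr => T TT.
  by rewrite !mulrA -(mulrA (T * g) T T) TT mulr1.
move=> g _ /=; move: (S) reflection_sqr => T TT.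
by rewrite !mulrA TT mul1r -mulrA TT mulr1.
Qed.

(** As [S * S = 1], being fixed means commuting with [S], an affine function of [D * D]. *)
Lemma fixed_reflectionP g :
  fixed_subgroup G (fun g => S * g * S) g <-> G g /\ g * (D * D) = (D * D) * g.
Proof.
have SSg : S * g * S = g <-> S * g = g * S.
  move: (S) reflection_sqr => T TT.
  split=> [Tg|->]; last by rewrite -mulrA TT mulr1.
  by rewrite -[X in _ = X * _]Tg -(mulrA (T * g) T T) TT mulr1.
split=> -[Gg]; [move/SSg => Sg|move=> Dg]; split => //.
  have {}Sg : 2 *: (g * (D * D)) = 2 *: (D * D * g).
    move: Sg; rewrite mulrBl mulrBr mul1r mulr1 -scalerAl -scalerAr => /addrI/oppr_inj.
    by move->.
  by apply: (scalerI _ Sg); rewrite pnatr_eq0.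
by apply/SSg; rewrite mulrBl mulrBr mul1r mulr1 -scalerAl -scalerAr Dg.
Qed.

(* An element of [G^sigma] permutes the two null lines of the plane of [D0]; the
   product of the two plane coordinates tells which one is hit and never vanishes
   on the image of a null vector. *)
Lemma fixed_component_ZGa g :
  identity_component (fixed_subgroup G (fun g => S * g * S)) g -> Z g.
Proof.
set F := fixed_subgroup _ _ => Cg.
have FP h : identity_component F h -> F h by exact: connected_component_sub.
have F1 : F 1 by apply/fixed_reflectionP; rewrite mul1r mulr1; split=> //; exact: Gpq1.
have [Gg gDD] := (fixed_reflectionP g).1 (FP _ Cg).
(* [D * D] projects onto the plane of [D0]; an element commuting with it preserves that plane. *)
have plane h v : F h -> D *m (D *m v) = v -> forall j, inner j -> (h *m v) j ord0 = 0.
  move=> /fixed_reflectionP[_ hD] Dv j /andP[j0 jm].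
  have -> : h *m v = (D * D) *m (h *m v) by rewrite -mulr_act -hD !mulr_act Dv.
  by rewrite mulr_act D0E (negbTE j0) (negbTE jm).
have etaP v : (forall j, inner j -> v j ord0 = 0) ->
    eta v v = v ord0 ord0 ^+ 2 - v ord_max ord0 ^+ 2.
  move=> v0; rewrite etaE (bigD1 ord0) //= (bigD1 ord_max) //= big1 => [|j jI].
    by rewrite sgn_eta0 sgn_eta_max; ring.
  by rewrite v0 ?mulr0.
(* For [b = 1] and [b = -1] this treats the two null lines at once: on the [b]-eigenline, [b] times
   the product of the plane coordinates is positive off 0, on the other one it is negative. *)
have key v (b : R) : b ^+ 2 = 1 -> D *m v = b *: v -> eta v v = 0 ->
    0 < b * (v ord0 ord0 * v ord_max ord0) -> D *m (g *m v) = b *: (g *m v).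
  move=> bb Dv vv vpos.
  have DDv : D *m (D *m v) = v by rewrite !(Dv, =^~ scalemxAr) scalerA -expr2 bb scale1r.
  have v0 : v != 0 by apply: contraTneq vpos => ->; rewrite mxE mul0r mulr0 ltxx.
  have sq h : F h -> (h *m v) ord0 ord0 ^+ 2 = (h *m v) ord_max ord0 ^+ 2.
    move=> Fh; have [Gh _] := Fh; apply/eqP.
    by rewrite -subr_eq0 -etaP ?Gpq_eta ?vv //; exact: plane.
  have gpos : 0 < b * ((g *m v) ord0 ord0 * (g *m v) ord_max ord0).
    apply: (@connected_sign _ _ _
      (fun h : mx => b * ((h *m v) ord0 ord0 * (h *m v) ord_max ord0))
      1 g (@component_connected _ F 1)) => //.
    - have c i : continuous (fun h : mx => (h *m v) i ord0).
        apply: continuous_entry; apply: continuous_mulmx; last exact: cst_continuous.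
        by move=> h; exact: cvg_id.
      pose w0 (h : mx) := (h *m v) ord0 ord0; pose wm (h : mx) := (h *m v) ord_max ord0.
      move=> h; apply: (@continuousM R mx (cst b) (fun h => w0 h * wm h)).
        exact: cst_continuous.
      by apply: (@continuousM R mx w0 wm); exact: c.
    (* The plane coordinates have equal squares, so if their product vanishes both do; then
       [h *m v = 0] and [v = 0]. *)
    - move=> h /FP Fh; apply: contraNneq v0 => hv.
      have {}hv : (h *m v) ord0 ord0 = 0 /\ (h *m v) ord_max ord0 = 0.
        have : (h *m v) ord0 ord0 ^+ 2 * (h *m v) ord_max ord0 ^+ 2 = 0.
          by rewrite -[LHS]mul1r -bb -!exprMn hv expr0n.
        rewrite (sq _ Fh) => /eqP; rewrite mulf_eq0 orbb sqrf_eq0 => /eqP hm.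
        by have /eqP := sq _ Fh; rewrite hm expr0n sqrf_eq0 => /eqP ->.
      have hv0 : h *m v = 0.
        apply/matrixP => j o; rewrite ord1 [RHS]mxE.
        have [->|j0] := eqVneq j ord0; first exact: hv.1.
        have [->|jm] := eqVneq j ord_max; first exact: hv.2.
        by apply: plane; rewrite // /inner j0 jm.
      have -> : v = h^-1 *m (h *m v).
        by rewrite -mulr_act mulVr ?mul1mx //; exact: Gpq_unit Fh.1.
      by rewrite hv0 mulmx0.
    - exact: connected_component_refl.
    - by rewrite mul1mx.
  have gE : (g *m v) ord_max ord0 = b * (g *m v) ord0 ord0.
    have : (g *m v) ord0 ord0 ^+ 2 = (g *m v) ord_max ord0 ^+ 2 by apply/sq/FP.
    move: gpos bb; move: (_ ord0 ord0) (_ ord_max ord0) => x y.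
    move=> gpos /eqP; rewrite sqrf_eq1 => bb /eqP; rewrite eqf_sqr.
    move=> xy; have {}gpos : 0 < b * (x * y) by [].
    case/orP: bb gpos => /eqP ->; case/orP: xy => /eqP ->.
    - by rewrite !mul1r.
    - by rewrite !mul1r mulNr -expr2 oppr_gt0 ltNge sqr_ge0.
    - by rewrite mulN1r -expr2 oppr_gt0 ltNge sqr_ge0.
    by rewrite !mulN1r opprK.
  apply/matrixP => j o; rewrite ord1 D0E [RHS]mxE gE.
  have [->|j0] := eqVneq j ord0 => //.
  have [->|jm] := eqVneq j ord_max; first by rewrite gE mulrA -expr2 bb mul1r.
  by rewrite plane ?mulr0 //; [exact: FP|rewrite /inner j0 jm].
apply/ZGaP; split=> //; apply: mx_levi_inj => [||i Ii]; rewrite !mulr_act.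
- rewrite D0_kplus (key _ 1) ?scale1r ?expr1n ?D0_kplus ?eta_kpp //.
  by rewrite kplus0 kplusmax !mulr1.
- rewrite D0_kminus (key _ (-1)) ?scaleN1r ?mulmxN ?sqrrN ?expr1n ?D0_kminus ?eta_kmm //.
  by rewrite kminus0 kminusmax mul1r mulrNN mulr1.
(* On the kernel of [D0]: [D * g] factors through [D * D] on the right, so it kills the inner basis
   vectors. *)
have Dg : D * g = D * (g * (D * D)) by rewrite gDD !mulrA D03.
by rewrite D0_inner // mulmx0 -[RHS]mulr_act Dg !mulr_act D0_inner // !mulmx0.
Qed.

Lemma MApq_symmetric : (2 < p + q)%N -> symmetric_subgroup G (MApq R p q).
Proof.
move=> d_gt2; rewrite MApqE //; split.
  split; [by move=> g []|exact: ZGa1|exact: ZGaM|exact: ZGaV].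
exists (fun g => S * g * S); first exact: conj_reflection_involution.
split=> [g|g /ZGaP[Gg gD]]; first exact: fixed_component_ZGa.
by apply/fixed_reflectionP; split => //; rewrite mulrA gD -mulrA gD mulrA.
Qed.

End Levi.

(** * Tensor maps and transitivity on pairs of points *)

Section TensorMaps.
Variable K : fieldType.

Lemma tmap1 (V W : vectType K) : tmap (\1 : 'End(V))%VF (\1 : 'End(W))%VF = \1%VF.
Proof.
apply/lfunP => x; rewrite id_lfunE lfunE /= /tmap_fun comp_lfun1l.
apply/lfunP => phi; rewrite comp_lfunE lfunE /= /precomp_fun.
by rewrite comp_lfun1r.
Qed.

Lemma tmapM (V V' V'' W W' W'' : vectType K) (f : 'Hom(V', V'')) (f' : 'Hom(V, V'))
    (g : 'Hom(W', W'')) (g' : 'Hom(W, W')) :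
  tmap (f \o f')%VF (g \o g')%VF = (tmap f g \o tmap f' g')%VF.
Proof.
apply/lfunP => x; rewrite comp_lfunE !lfunE /= /tmap_fun.
apply/lfunP => phi; rewrite !comp_lfunE !lfunE /= /precomp_fun.
by rewrite comp_lfunA.
Qed.

Variables (V1 V2 V3 V4 : vectType K).

Lemma tmap4_id : tmap4 \1 \1 \1 \1 = \1%VF :> 'End(tensor4 V1 V2 V3 V4).
Proof. by rewrite /tmap4 !tmap1. Qed.

Lemma tmap4M (f1 g1 : 'End(V1)) (f2 g2 : 'End(V2)) (f3 g3 : 'End(V3))
    (f4 g4 : 'End(V4)) :
  tmap4 (f1 \o g1) (f2 \o g2) (f3 \o g3) (f4 \o g4) =
  (tmap4 f1 f2 f3 f4 \o tmap4 g1 g2 g3 g4)%VF.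
Proof. by rewrite /tmap4 !tmapM. Qed.

End TensorMaps.

(** The inverse of linear maps cancels on the left only for an injective map, so injectivity is
    first derived from the left inverse [rho g^-1]. *)
Lemma is_module_inv (R : realType) n (K : fieldType) (H : set 'M[R]_n.+1)
    (V : vectType K) (rho : 'M[R]_n.+1 -> 'End(V)) g :
  is_module H rho -> H g -> H g^-1 -> g \is a GRing.unit ->
  (rho g)^-1%VF = rho g^-1.
Proof.
move=> [rho1 rhoM] Hg Hg' gu.
have rl : (rho g^-1%R \o rho g)%VF = \1%VF by rewrite -rhoM // mulVr.
have rr : (rho g \o rho g^-1%R)%VF = \1%VF by rewrite -rhoM // mulrV.
have k0 : lker (rho g) == 0%VS.
  apply/lker0P => x y xy; rewrite -[x]id_lfunE -[y]id_lfunE -rl.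
  by rewrite !comp_lfunE xy.
by rewrite -[LHS]comp_lfun1r -rr comp_lfunA lker0_compVf // comp_lfun1l.
Qed.

(** * Siegel transformations and the action of [G] on points of the quadric *)

Section Transitivity.
Variables (R : realType) (p q : nat).
Local Notation mx := 'M[R]_((p + q).+2).
Local Notation vec := 'cV[R]_((p + q).+2).
Local Notation G := (Gpq R p q).
Local Notation Q := (Qpq R p q).
Local Notation J := (eta_mx R p q).
Local Notation kp := (kplus R p q).
Local Notation km := (kminus R p q).
Local Notation eta := Defs.eta.
Local Notation iota0 := (@Defs.iota0 R p q).
Local Notation infty := (@Defs.infty R p q).
Implicit Types (g h : mx) (u v x y : vec).

Lemma rank1_act u x v : u *m (x^T *m J) *m v = eta x v *: u.
Proof.
rewrite -mulmxA [_ *m v]mx11_scalar mul_mx_scalar; congr (_ *: _).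
Qed.

(* The Siegel (Eichler) transformation, an isometry fixing [kp] when u is
   orthogonal to [kp]; the last coefficient makes it preserve the form. *)
Definition siegel u : mx :=
  1 + u *m (kp^T *m J) - kp *m (u^T *m J)
  - (2^-1 * eta u u) *: (kp *m (kp^T *m J)).

Lemma siegelE u v : siegel u *m v =
  v + eta kp v *: u - (eta u v + 2^-1 * eta u u * eta kp v) *: kp.
Proof.
rewrite /siegel 3!mulmxDl !mulNmx mul1mx -scalemxAl !rank1_act.
by rewrite scalerA scalerDl opprD addrA.
Qed.

Lemma siegel_isometry u : eta kp u = 0 -> isometry (siegel u).
Proof.
move=> ku; apply/isometryP => v x; rewrite !siegelE.
have uk : eta u kp = 0 by rewrite etaC.
move: (kp) ku uk (eta_kpp R p q) => k ku uk kk.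
rewrite !(etaDl, etaDr, etaNl, etaNr, etaZl, etaZr) kk ku uk.
rewrite (etaC v k) (etaC v u).
by field.
Qed.

Lemma continuous_siegel u : continuous (fun t : R => siegel (t *: u)).
Proof.
have c : continuous (fun t : R => t *: u).
  by move=> t; apply: cvgZr_tmp; exact: cvg_id.
have cJ (f : R -> vec) : continuous f -> continuous (fun t : R => (f t)^T *m J).
  by move=> cf; apply: continuous_mulmx; [exact: continuous_trmx|exact: cst_continuous].
have ce : continuous (fun t : R => eta (t *: u) (t *: u)).
  by apply: continuous_entry; apply: continuous_mulmx => //; exact: cJ.
have c1 : continuous (fun t : R => (t *: u) *m (kp^T *m J)).
  by apply: continuous_mulmx => //; exact: cst_continuous.
have c2 : continuous (fun t : R => kp *m ((t *: u)^T *m J)).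
  by apply: continuous_mulmx; [exact: cst_continuous|exact: cJ].
move=> t; apply: cvgB; first apply: cvgB; first apply: cvgD; first exact: cvg_cst.
- exact: c1.
- exact: c2.
by apply: cvgZr_tmp; apply: cvgM; [exact: cvg_cst|exact: ce].
Qed.

(** Shrinking [u] to 0 gives a path of isometries to the identity. *)
Lemma siegel_Gpq u : eta kp u = 0 -> G (siegel u).
Proof.
move=> ku; rewrite -[u]scale1r; apply: (@path_Gpq _ _ _ (fun t => siegel (t *: u))).
- exact: continuous_siegel.
- apply: mx_coord_inj => v j; rewrite siegelE scale0r -(scale0r kp) !etaZl.
  by rewrite !(mul0r, mulr0) addr0 !scale0r scaler0 subr0 addr0 mul1mx.
by move=> t _; apply: siegel_isometry; rewrite etaZr ku mulr0.
Qed.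

Lemma gact1 (x : set vec) : gact 1 x = x.
Proof.
rewrite /gact; under eq_imagel do rewrite mul1mx.
by rewrite image_id.
Qed.

Lemma gactM g h (x : set vec) : gact (g * h) x = gact g (gact h x).
Proof. by rewrite /gact image_comp; apply: eq_imagel => v _; rewrite /= mulr_act. Qed.

Lemma gact_pt g v : gact g (pt v) = pt (g *m v).
Proof.
apply/seteqP; split => [_ [_ [c c0 <-] <-]|_ [c c0 <-]].
  by exists c => //; rewrite scalemxAr.
by exists (c *: v); [exists c|rewrite scalemxAr].
Qed.

Lemma ptZ (c : R) v : c != 0 -> pt (c *: v) = pt v.
Proof.
move=> c0; apply/seteqP; split => _ [b b0 <-].
  by exists (b * c); rewrite ?scalerA //= mulf_neq0.
by exists (b / c); rewrite ?scalerA ?mulfVK //= mulf_neq0 // invr_neq0.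
Qed.

Lemma pt_inj u v : pt u = pt v -> exists2 c : R, c != 0 & u = c *: v.
Proof.
move=> uv; have : pt u u by exists 1; rewrite ?scale1r //= oner_eq0.
by rewrite uv => -[c c0 <-]; exists c.
Qed.

Lemma gact_inv g (x y : set vec) : G g -> gact g x = y -> gact g^-1 y = x.
Proof. by move=> Gg <-; rewrite -gactM mulVr ?gact1 // Gpq_unit. Qed.

Lemma QpqV g : Q g -> Q g^-1.
Proof. by move=> [Gg gi]; split; [exact: GpqV|exact: gact_inv]. Qed.

(** After translation by [g^-1] the first point is the line of [kp]; a Siegel transformation fixes
    [kp] and moves [km] to a representative of the second point. *)
Lemma Gpq_transitive2 g h : G g -> G h -> eta (g *m kp) (h *m kp) != 0 ->
  exists k, [/\ G k, gact k iota0 = gact g iota0 & gact k infty = gact h iota0].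
Proof.
move=> Gg Gh; set a := eta _ _ => a0.
(* The factor [2 / a] normalises [eta kp v] to [eta kp km = 2]. *)
have [v vE] : exists v, v = (2 / a) *: (g^-1 *m (h *m kp)) by eexists.
have gu := Gpq_unit Gg.
have gKv x : g *m (g^-1 *m x) = x by rewrite -mulr_act mulrV // mul1mx.
have kv : eta kp v = 2.
  by rewrite vE etaZr -(Gpq_eta _ _ Gg) gKv -/a mulfVK.
have vv : eta v v = 0.
  by rewrite vE etaZl etaZr -(Gpq_eta _ _ Gg) gKv Gpq_eta // eta_kpp !mulr0.
(* [siegel u] sends [km] to [km + 2 u] plus a multiple of [kp]; the multiple is 0 because [v] and
   [km] are null. *)
pose u : vec := 2^-1 *: (v - km).
have ku : eta kp u = 0 by rewrite etaZr etaDr etaNr kv eta_kpm subrr mulr0.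
have skp : siegel u *m kp = kp.
  rewrite siegelE eta_kpp scale0r addr0 mulr0 addr0 etaC ku scale0r.
  by rewrite subr0.
have skm : siegel u *m km = v.
  rewrite siegelE eta_kpm /u; move: (km) (eta_kmm R p q) => l ll.
  rewrite !(etaDl, etaDr, etaNl, etaNr, etaZl, etaZr) vv ll (etaC l v).
  by move: (eta v l) => b; apply/matrixP => i j; rewrite !mxE; field.
exists (g * siegel u); split; first by apply: GpqM => //; exact: siegel_Gpq.
- by rewrite /Defs.iota0 !gact_pt mulr_act skp.
rewrite /Defs.infty /Defs.iota0 !gact_pt mulr_act skm vE -scalemxAr gKv ptZ //.
by rewrite mulf_neq0 ?pnatr_eq0 // invr_neq0.
Qed.

(** Representatives of a point differ by nonzero scalars, which do not affect non-orthogonality. *)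
Lemma GP_eta m (x : m.-tuple (set vec)) i j u v : GP x -> i != j ->
  tnth x i = pt u -> tnth x j = pt v -> eta u v != 0.
Proof.
move=> [_ [z [xz _ zz]]] ij; rewrite !xz => /pt_inj[c c0 zi] /pt_inj[b b0 zj].
have := zz _ _ ij; rewrite zi zj etaZl etaZr.
by apply: contraNneq => ->; rewrite !mulr0.
Qed.

Lemma GP_gact m (x : m.-tuple (set vec)) g : G g -> GP x -> GP (map_tuple (gact g) x).
Proof.
move=> Gg [xq [v [xv /freeP vf vv]]]; have gu := Gpq_unit Gg.
have gK y : g^-1 *m (g *m y) = y by rewrite -mulr_act mulVr // mul1mx.
split=> [i|].
  rewrite tnth_map; have [y [y0 yy] <-] := xq i; exists (g *m y); last by rewrite gact_pt.
  split; last by rewrite Gpq_eta.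
  by apply: contra_neq y0 => gy; rewrite -[y]gK gy mulmx0.
exists (map_tuple (mulmx g) v); split.
- by move=> i; rewrite !tnth_map xv gact_pt.
- apply/freeP => k kv; apply: vf; rewrite -[LHS]gK.
  suff -> : g *m (\sum_(i < m) k i *: v`_i) = 0 by rewrite mulmx0.
  rewrite mulmx_sumr -[RHS]kv; apply: eq_bigr => i _; rewrite -scalemxAr.
  by rewrite (nth_map 0) ?size_tuple.
by move=> i j ij; rewrite !tnth_map Gpq_eta // vv.
Qed.

Lemma GP4_gact (x1 x2 x3 x4 : set vec) g : G g -> GP [tuple x1; x2; x3; x4] ->
  GP [tuple gact g x1; gact g x2; gact g x3; gact g x4].
Proof.
move=> Gg /(GP_gact Gg).
suff -> : map_tuple (gact g) [tuple x1; x2; x3; x4] =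
  [tuple gact g x1; gact g x2; gact g x3; gact g x4] by [].
exact: val_inj.
Qed.

(** * The tuples [(1, w, g, g * w)] and the normal form on [U] *)

Variable w : mx.
Hypothesis w_spec : is_w w.

Lemma Gtilde_Upq g : Gtilde R p q g -> Upq R p q (1, w, g, g * w).
Proof.
case: w_spec => Gw _ _ wi _ [Gg gGP]; split.
  by split=> //; [exact: Gpq1|exact: GpqM].
by rewrite gact1 gactM wi.
Qed.

(** Elements of [MA] scale both [kp] and [km], so they fix both base points, which [w] exchanges. *)
Lemma MApq_Qpq h : MApq R p q h -> Q h /\ Q (w * h * w).
Proof.
have MA_Z k : MApq R p q k -> ZGa R p q k.
  by move=> [m [Zm _] [a /Apq_ZGa Za <-]]; exact: ZGaM.
case: w_spec => Gw _ _ wi wo /MA_Z Zh.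
have [lam [l0 hp hm]] := ZGa_eigen Zh; have Gh := Zh.1.
split; split => //.
- by rewrite gact_pt hp ptZ.
- by do 2?apply: GpqM.
by rewrite !gactM wi gact_pt hm ptZ ?invr_neq0.
Qed.

(* Moving the first two points to the base pair and then the last two by some h
   normalises a point of U to (1, w, h, hw) modulo G on the left and Q on the right. *)
Lemma Upq_normal_form g1 g2 g3 g4 : Upq R p q (g1, g2, g3, g4) ->
  exists g h q1 q2 q3 q4, [/\ G g, Gtilde R p q h,
    [/\ Q q1, Q q2, Q q3 & Q q4] &
    (g1, g2, g3, g4) = (g * 1 * q1, g * w * q2, g * h * q3, g * (h * w) * q4)].
Proof.
case: w_spec => Gw _ ww wi wo [[G1 G2 G3 G4] GP4].
have [g [Gg gi go]] : exists k, [/\ G k, gact k iota0 = gact g1 iota0 &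
    gact k infty = gact g2 iota0].
  apply: Gpq_transitive2 => //.
  by apply: (GP_eta (i := ord0) (j := 1) GP4) => //; rewrite /tnth /= gact_pt.
have [k [Gk ki ko]] : exists k, [/\ G k, gact k iota0 = gact g3 iota0 &
    gact k infty = gact g4 iota0].
  apply: Gpq_transitive2 => //.
  by apply: (GP_eta (i := 2) (j := 3) GP4) => //; rewrite /tnth /= gact_pt.
have gu := Gpq_unit Gg; have ku := Gpq_unit Gk.
have Gg' := GpqV Gg; have Gk' := GpqV Gk.
(* [g] and [g1] agree on [iota0], and so do [g * w] and [g2]; hence the quotients stabilise [iota0].
   The same holds for [k], [g3], [g4]. *)
exists g, (g^-1 * k), (g^-1 * g1), (w * g^-1 * g2), (k^-1 * g3), (w * k^-1 * g4).
split => //.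
- split; first exact: GpqM.
  move: (GP4_gact Gg' GP4).
  by rewrite -gi -go -ki -ko -!gactM mulVr // !gact1.
- split; split; do ?[exact: GpqM|by do 2?apply: GpqM].
  + by rewrite gactM (gact_inv Gg gi).
  + by rewrite !gactM (gact_inv Gg go).
  + by rewrite gactM (gact_inv Gk ki).
  + by rewrite !gactM (gact_inv Gk ko).
have wK (x : mx) : w * (w * x) = x by rewrite mulrA ww mul1r.
rewrite -!mulrA !wK !mul1r !(mulVKr gu) !(mulVKr ku).
by rewrite ?(mulVKr gu, mulVKr ku).
Qed.

End Transitivity.

(** [a] is a combination of 1, [D0] and its square, so [m] commutes with it and the order of the
    inverses can be exchanged. *)
Lemma Mpq_Apq_inv (R : realType) (p q : nat) (m a : 'M[R]_((p + q).+2)) :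
  Mpq R p q m -> Apq R p q a -> (m * a)^-1 = m^-1 * a^-1.
Proof.
move=> [Zm _] Aa; have mu := ZGa_unit Zm; have au := ZGa_unit (Apq_ZGa Aa).
have [t aE] := (ApqP a).1 Aa; have [_ mD] := (ZGaP m).1 Zm.
have ma : GRing.comm m a.
  have commZ (c : R) x : GRing.comm m x -> GRing.comm m (c *: x).
    by rewrite /GRing.comm -scalerAl -scalerAr => ->.
  have mDD : GRing.comm m (D0 R p q * D0 R p q) by exact: commrM.
  rewrite aE mexp_D0; apply: commrD; last by apply: commrB => //; exact: commr1.
  by apply: commrD; apply/commZ/commZ; [exact: commrD|exact: commrB].
by rewrite [m * a]ma invrM.
Qed.

(* The scalar field K is a finite extension of R, that is, R itself or the
   complex numbers. *)
Theorem theorem5p24 (R : realType) (p q : nat) (le_qp : (q <= p)%N)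
    (d_gt2 : (2 < p + q)%N)
    (w : 'M[R]_((p + q).+2)) (w_spec : is_w w)
    (K : fieldExtType R) (V1 V2 V3 V4 : vectType K)
    (pi1 : 'M[R]_((p + q).+2) -> 'End(V1)) (pi2 : 'M[R]_((p + q).+2) -> 'End(V2))
    (pi3 : 'M[R]_((p + q).+2) -> 'End(V3)) (pi4 : 'M[R]_((p + q).+2) -> 'End(V4))
    (pi1_mod : is_module (Qpq R p q) pi1) (pi2_mod : is_module (Qpq R p q) pi2)
    (pi3_mod : is_module (Qpq R p q) pi3) (pi4_mod : is_module (Qpq R p q) pi4) :
  (exists lact ract : 'M[R]_((p + q).+2) -> 'End(tensor4 V1 V2 V3 V4),
    [/\ forall m a v1 v2 v3 v4, Mpq R p q m -> Apq R p q a ->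
          lact (m * a) (pure4 v1 v2 v3 v4) =
          pure4 (pi1 (m * a) v1) (pi2 (w * m * a * w) v2) v3 v4,
        forall m a v1 v2 v3 v4, Mpq R p q m -> Apq R p q a ->
          ract (m * a) (pure4 v1 v2 v3 v4) =
          pure4 v1 v2 (pi3 (m^-1 * a^-1) v3) (pi4 (w * m^-1 * a^-1 * w) v4) &
        forall f, smooth_ward pi1 pi2 pi3 pi4 f ->
          matrix_spherical (Gpq R p q) (MApq R p q) (Gtilde R p q) lact ract
            (restrictF w f)])
  /\
  (forall f f', smooth_ward pi1 pi2 pi3 pi4 f -> smooth_ward pi1 pi2 pi3 pi4 f' ->
     (forall g, Gtilde R p q g -> restrictF w f g = restrictF w f' g) ->
     forall x, Upq R p q x -> f x = f' x).
Proof.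
case: (w_spec) => Gw _ ww wi wo.
have wV : w^-1 = w by rewrite -[LHS]mulr1 -ww mulKr // Gpq_unit.
have wK (x : 'M[R]_((p + q).+2)) : w * (w * x) = x by rewrite mulrA ww mul1r.
have MA : MApq R p q = ZGa R p q by exact: MApqE.
have MAQ h : MApq R p q h -> Qpq R p q h /\ Qpq R p q (w * h * w).
  by move=> ?; exact: MApq_Qpq.
have MAV h : MApq R p q h -> MApq R p q h^-1 by rewrite MA; exact: ZGaV.
have MAu h : MApq R p q h -> h \is a GRing.unit by rewrite MA; exact: ZGa_unit.
have conjM g h : w * (g * h) * w = (w * g * w) * (w * h * w) by rewrite -!mulrA wK.
have piV (V : vectType K) (rho : 'M[R]_((p + q).+2) -> 'End(V)) g :
    is_module (Qpq R p q) rho -> Qpq R p q g -> (rho g)^-1%VF = rho g^-1%R.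
  by move=> mod Qg; apply: (is_module_inv mod) => //; [exact: QpqV|case: Qg => /Gpq_unit].
(* Injectivity first: at a normal form the Ward identities apply one and the same linear map to the
   values of [f] and [f'] at [(1, w, h, h * w)]. *)
split; last first.
  move=> f f' [_ fW] [_ fW'] ff' [[[g1 g2] g3] g4] Ux.
  have [g [h [q1 [q2 [q3 [q4 [Gg Gh [Q1 Q2 Q3 Q4] ->]]]]]]] := Upq_normal_form w_spec Ux.
  have Uh := Gtilde_Upq w_spec Gh.
  rewrite (fW _ _ _ _ _ _ _ _ _ Gg Uh) // (fW' _ _ _ _ _ _ _ _ _ Gg Uh) //.
  by rewrite -!/(restrictF w _ h) ff'.
(* In the second witness, inverting [h] reverses the order of products and so gives a right
   action. *)
exists (fun h => tmap4 (pi1 h) (pi2 (w * h * w)) \1 \1)%VF.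
exists (fun h => tmap4 \1 \1 (pi3 h^-1%R) (pi4 (w * h^-1%R * w)%R))%VF.
have [[p11 p1M] [p21 p2M]] := (pi1_mod, pi2_mod).
have [[p31 p3M] [p41 p4M]] := (pi3_mod, pi4_mod).
split.
- move=> m a v1 v2 v3 v4 _ _; rewrite tmap4E !id_lfunE.
  by rewrite !mulrA.
- move=> m a v1 v2 v3 v4 Mm Aa; rewrite tmap4E !id_lfunE.
  by rewrite (Mpq_Apq_inv Mm Aa) !mulrA.
move=> f [_ fW]; split.
- exact: MApq_symmetric.
- split=> [|g h Mg Mh]; first by rewrite mulr1 ww p11 p21 tmap4_id.
  have [Qg Qwg] := MAQ _ Mg; have [Qh Qwh] := MAQ _ Mh.
  by rewrite conjM p1M // p2M // -tmap4M !comp_lfun1l.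
- split=> [|g h Mg Mh]; first by rewrite invr1 mulr1 ww p31 p41 tmap4_id.
  have [Qg Qwg] := MAQ _ (MAV _ Mg); have [Qh Qwh] := MAQ _ (MAV _ Mh).
  by rewrite invrM ?MAu // conjM p3M // p4M // -tmap4M !comp_lfun1l.
move=> g h h' Gg Mh Mh'.
have Uh := Gtilde_Upq w_spec Gg; have Gh : Gpq R p q h by move: Mh; rewrite MA => -[].
have [Qh Qwh] := MAQ _ Mh; have [Qh' Qwh'] := MAQ _ Mh'.
have [QhV QwhV] := MAQ _ (MAV _ Mh).
(* Left translation by [h] is undone on the first two entries by the elements [h^-1] and
   [w * h^-1 * w] of [Q], while [h'] and [w * h' * w] turn the last two into [h * g * h'] and
   [h * g * h' * w]. *)
have := fW h 1 w g (g * w) h^-1 (w * h^-1 * w) h' (w * h' * w) Gh Uh QhV QwhV Qh' Qwh'.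
have -> : h * 1 * h^-1 = 1 by rewrite mulr1 mulrV ?MAu.
have -> : h * w * (w * h^-1 * w) = w by rewrite -!mulrA wK mulVKr ?MAu.
have -> : h * (g * w) * (w * h' * w) = h * g * h' * w by rewrite -!mulrA wK.
rewrite /restrictF => ->; rewrite -comp_lfunE -tmap4M !comp_lfun1l !comp_lfun1r.
have conjV k : MApq R p q k -> (w * k * w)^-1 = w * k^-1 * w.
  move=> Mk; have ku := MAu _ Mk; have wu := Gpq_unit Gw.
  have wku : w * k \is a GRing.unit by rewrite unitrMl.
  by rewrite (invrM wku wu) (invrM wu ku) wV mulrA.
by rewrite !piV // !conjV ?invrK //; exact: MAV.
Qed.
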